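(* For any $\boldsymbol\theta\in\mathbb R^N_+$, $\mathbf m\in\mathbb R^N_+$, $\sigma>0$ (and any fixed $p>0$) the equilibrium equations $$\sum_{k=1}^N m_k(y_k-y_i)+\sigma(\theta_i-y_i^p)y_i=0,\qquad i=1,\dots,N,$$ have a unique solution $\mathbf y^*\in\mathbb R^N_+$. This $\mathbf y^*$ is a locally exponentially stable equilibrium of system (OY), and the map $(\boldsymbol\theta,\mathbf m,\sigma)\mapsto\mathbf y^*(\boldsymbol\theta,\mathbf m,\sigma)$ from $\mathbb R^N_+\times\mathbb R^N_+\times\mathbb R_+$ to $\mathbb R^N_+$ is $C^\infty$. Moreover, for every sectorial solution $(\mathbf v_1,\dots,\mathbf v_N)$ of system (OV) there exists a unit vector $\tilde{\mathbf v}\in\mathbb S^{n-1}$ such that $\mathbf v_i(t)\to y_i^*\tilde{\mathbf v}$ as $t\to\infty$ for every $i$. In particular, every solution of (OY) with $y_i(0)>0$ for all $i$ converges to $\mathbf y^*$ as $t\to\infty$.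
   Context: $\mathbb R^N_+$ denotes the set of vectors with all coordinates strictly positive. Fix $N\ge1$, $n\ge1$, masses $m_i>0$ with $M=\sum_i m_i$, constants $\theta_i>0$ (constant in time), $\sigma>0$, $p>0$. System (OV) for velocities $\mathbf v_i\in\mathbb R^n$ is $$\dot{\mathbf v}_i=\sum_{j=1}^N m_j(\mathbf v_j-\mathbf v_i)+\sigma(\theta_i-|\mathbf v_i|^p)\mathbf v_i,\quad i=1,\dots,N,$$ ($|\cdot|$ Euclidean norm). A solution of (OV) is sectorial if there exists a unit vector $\mathbf e\in\mathbb R^n$ with $\mathbf e\cdot\mathbf v_i(0)>0$ for all $i$. System (OY) for scalars $y_i$ is $$\dot y_i=\sum_{k=1}^N m_k(y_k-y_i)+\sigma(\theta_i-y_i^p)y_i,\quad i=1,\dots,N.$$ *)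

(* Defs.v *)
From HB Require Import structures.
From mathcomp Require Import all_boot all_order all_algebra.
From mathcomp Require Import all_classical all_reals all_analysis.
Set Implicit Arguments. Unset Strict Implicit. Unset Printing Implicit Defensive.
Import Order.TTheory GRing.Theory Num.Theory.
Import numFieldNormedType.Exports.
Local Open Scope classical_set_scope.
Local Open Scope ring_scope.

(* Euclidean norm and inner product on R^n (the library norm on 'rV is the
   max-norm, so we define the Euclidean one explicitly). *)
Definition enorm {R : realType} {n : nat} (x : 'rV[R]_n) : R :=
  Num.sqrt (\sum_(k < n) x 0 k ^+ 2).
Definition edot {R : realType} {n : nat} (x y : 'rV[R]_n) : R :=
  \sum_(k < n) x 0 k * y 0 k.

Definition posvec {R : realType} {N : nat} (x : 'rV[R]_N) : Prop :=
  forall i, 0 < x 0 i.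

Definition rhsOY {R : realType} {N : nat} (theta m : 'rV[R]_N) (sigma p : R)
  (y : 'rV[R]_N) : 'rV[R]_N :=
  \row_i (\sum_(k < N) m 0 k * (y 0 k - y 0 i)
          + sigma * (theta 0 i - y 0 i `^ p) * y 0 i).

Definition equilibrium {R : realType} {N : nat} (theta m : 'rV[R]_N) (sigma p : R)
  (y : 'rV[R]_N) : Prop :=
  forall i : 'I_N, \sum_(k < N) m 0 k * (y 0 k - y 0 i)
                   + sigma * (theta 0 i - y 0 i `^ p) * y 0 i = 0.

Definition tdom {R : realType} (T : \bar R) : set R :=
  [set t | 0 <= t /\ (t%:E < T)%E].

Definition solOY {R : realType} {N : nat} (theta m : 'rV[R]_N) (sigma p : R)
  (T : \bar R) (y : R -> 'rV[R]_N) : Prop :=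
  {within tdom T, continuous y} /\
  forall t, 0 < t -> (t%:E < T)%E ->
    derivable y t 1 /\ 'D_1 y t = rhsOY theta m sigma p (y t).

Definition solOV {R : realType} {N n : nat} (theta m : 'rV[R]_N) (sigma p : R)
  (v : R -> 'I_N -> 'rV[R]_n) : Prop :=
  forall i : 'I_N,
    {within [set t | 0 <= t], continuous (fun t => v t i)} /\
    forall t, 0 < t ->
      derivable (fun s => v s i) t 1 /\
      'D_1 (fun s => v s i) t =
        \sum_(j < N) m 0 j *: (v t j - v t i)
        + (sigma * (theta 0 i - enorm (v t i) `^ p)) *: v t i.

Definition sectorial {R : realType} {N n : nat} (v : R -> 'I_N -> 'rV[R]_n) : Prop :=
  exists e : 'rV[R]_n, enorm e = 1 /\ forall i, 0 < edot e (v 0 i).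

Definition loc_exp_stable {R : realType} {N : nat} (theta m : 'rV[R]_N) (sigma p : R)
  (ystar : 'rV[R]_N) : Prop :=
  exists delta C lambda : R, 0 < delta /\ 0 < C /\ 0 < lambda /\
    forall (T : \bar R) (y : R -> 'rV[R]_N), solOY theta m sigma p T y ->
      `|y 0 - ystar| < delta ->
      forall t, tdom T t ->
        `|y t - ystar| <= C * expR (- lambda * t) * `|y 0 - ystar|.

(* C^k on a set U (U open in the applications), via iterated directional
   derivatives: C^0 = continuous on U; C^(k+1) = all directional derivatives
   exist on U and are C^k on U. *)
Fixpoint Ck {R : realType} {V W : normedModType R} (k : nat) (U : set V)
  (f : V -> W) : Prop :=
  match k with
  | 0 => {within U, continuous f}
  | k'.+1 => forall v : V, (forall x, U x -> derivable f x v) /\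
                           Ck k' U (fun x => 'D_v f x)
  end.

Definition smooth_on {R : realType} {V W : normedModType R} (U : set V)
  (f : V -> W) : Prop := forall k, Ck k U f.

Definition paramdom {R : realType} (N : nat) : set ('rV[R]_N * 'rV[R]_N * R) :=
  [set z | posvec z.1.1 /\ posvec z.1.2 /\ 0 < z.2].

(* Main.v *)
(** For [theta], [m], [sigma] fixed, scaling a positive equilibrium [z] by [r]
    turns the vector field into [sigma (1 - r^p) z^p] times [r z], and the field
    is cooperative. So [r(t) z] is a strict super- or subsolution as soon as [r]
    relaxes to 1 slowly enough, and comparison with such barriers gives
    uniqueness, continuity in the parameters, exponential stability and global
    convergence. Existence follows by taking the coordinatewise supremum of
    the positive subsolutions.

    Along a solution of (OV), all projections [w . v_i] solve one and the same
    linear cooperative system. The ratio of any projection to a positive one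
    obeys a consensus equation whose weights are bounded below, hence all
    [v_i / (e . v_i)] converge to a common vector [V]. Then [|V| (e . v_i)] solves
    (OY) with [y_i^p] replaced by [c_i(t) y_i^p], [c_i(t) -> 1], and the same
    barriers apply.

    Smoothness: each directional derivative of the equilibrium map is obtained
    by inverting the Jacobian explicitly, and lies in a class of functions closed
    under directional derivatives. *)
Require Import Defs.
From HB Require Import structures.
From mathcomp Require Import all_boot all_order all_algebra.
From mathcomp Require Import all_classical all_reals all_analysis.
From mathcomp Require Import ring lra.
Set Implicit Arguments. Unset Strict Implicit. Unset Printing Implicit Defensive.
Import Order.TTheory GRing.Theory Num.Theory.
Import numFieldNormedType.Exports.
Local Open Scope classical_set_scope.
Local Open Scope ring_scope.

(** * Derivatives and a barrier principle *)

Section Derivatives.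
Context {R : realType} {V : normedModType R}.
Implicit Types (f g : V -> R) (x v : V).

Lemma is_deriveD_fun f g x v df dg :
  is_derive x v f df -> is_derive x v g dg ->
  is_derive x v (fun y => f y + g y) (df + dg).
Proof. by move=> ? ?; exact: is_deriveD. Qed.

Lemma is_deriveB_fun f g x v df dg :
  is_derive x v f df -> is_derive x v g dg ->
  is_derive x v (fun y => f y - g y) (df - dg).
Proof. by move=> ? ?; exact: is_deriveB. Qed.

Lemma is_deriveM_fun f g x v df dg :
  is_derive x v f df -> is_derive x v g dg ->
  is_derive x v (fun y => f y * g y) (f x * dg + g x * df).
Proof. by move=> ? ?; exact: is_deriveM. Qed.

Lemma is_deriveZ_fun f (c : R) x v df :
  is_derive x v f df -> is_derive x v (fun y => c * f y) (c * df).
Proof. by move=> ?; exact: is_deriveZ. Qed.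

Lemma is_derive_sum_fun (n : nat) (h : 'I_n -> V -> R) (dh : 'I_n -> R) x v :
  (forall i, is_derive x v (h i) (dh i)) ->
  is_derive x v (fun y => \sum_(i < n) h i y) (\sum_(i < n) dh i).
Proof.
move=> hd; rewrite (_ : (fun y => _) = \sum_(i < n) h i); last first.
  by apply/funext => y; rewrite fct_sumE.
exact: is_derive_sum.
Qed.

Lemma is_deriveV_fun f x v df : f x != 0 -> is_derive x v f df ->
  is_derive x v (fun y => (f y)^-1) (- (f x) ^- 2 * df).
Proof.
move=> fx0 fd; split; first exact: derivableV.
by rewrite deriveV// derive_val.
Qed.

Lemma is_derive_line f x v df : is_derive x v f df <->
  is_derive (0 : R) 1 (fun h : R => f (h *: v + x)) df.
Proof.
have E : 'D_v f x = 'D_1 (fun h : R => f (h *: v + x)) 0.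
  rewrite /derive; set g1 := fun h => h^-1 *: _; set g2 := fun h => h^-1 *: _.
  suff -> : g1 = g2 by [].
  apply/funext => h; rewrite /g1 /g2 /=.
  by rewrite addr0 scale0r add0r [_%:A]mulr1.
split=> -[d1 <-]; split => //.
- by rewrite -derivable1P.
- by rewrite derivable1P.
Qed.

Lemma is_derive_comp f (g : R -> R) x v df dg :
  is_derive x v f df -> is_derive (f x) 1 g dg ->
  is_derive x v (fun y => g (f y)) (dg * df).
Proof.
move=> /is_derive_line fd gd; apply/is_derive_line.
have gd' : is_derive ((fun h : R => f (h *: v + x)) 0) 1 g dg.
  by rewrite scale0r add0r.
exact: (@is_derive1_comp R g (fun h : R => f (h *: v + x)) 0 dg df).
Qed.

End Derivatives.

Lemma is_derive_continuous {R : realType} (f : R -> R) (t d : R) :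
  is_derive t 1 f d -> {for t, continuous f}.
Proof.
by move=> [fd _]; apply/differentiable_continuous/derivable1_diffP.
Qed.

Lemma is_derive_near_lt {R : realType} (f : R -> R) (t d : R) :
  is_derive t 1 f d -> 0 < d -> \forall s \near t^'-, f s < f t.
Proof.
move=> [fd fE] d0; have := fd; rewrite /derivable => fc.
have fl : (fun h => h^-1 *: ((f \o shift t) (h *: 1) - f t)) @ 0^' --> d.
  by rewrite -fE; exact: fc.
have : \forall h \near 0^', 0 < h^-1 *: ((f \o shift t) (h *: 1) - f t).
  exact: (cvgr_gt d fl).
rewrite /= near_withinE => /nbhs_ballP[e /= e0 He].
apply/nbhs_ballP; exists e => //= s; rewrite /ball/= => se st.
have := He (s - t); rewrite /= /ball/= sub0r normrN distrC => /(_ se).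
rewrite subr_eq0 lt_eqF// => /(_ isT).
rewrite /shift /= [_ *: 1]mulr1 subrK.
by rewrite /GRing.scale/= nmulr_rgt0 ?invr_lt0 ?subr_lt0.
Qed.

Section Barrier.
Context {R : realType}.

(** First-contact argument. At the supremum of the times up to which all [f i] are positive, a
    vanishing [f i] would have positive derivative while the others are nonnegative, hence be
    negative just before. Positivity is asked near [a] on the right only, so that the [f i] may
    start from a mere right limit. *)
Lemma barrier (I : finType) (f : I -> R -> R) (a b : R) :
  (forall i, \forall t \near a^'+, 0 < f i t) ->
  (forall i t, a < t <= b -> {for t, continuous (f i)}) ->
  (forall i t, a < t <= b -> (forall j, 0 <= f j t) -> f i t = 0 ->
     exists2 d, is_derive t 1 (f i) d & 0 < d) ->
  forall t i, a < t <= b -> 0 < f i t.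
Proof.
move=> f0 fc fd.
pose A := [set t | t <= b /\ forall s, a < s <= t -> forall i, 0 < f i s].
have [ab|ba] := ltP a b; last first.
  by move=> t i /andP[/lt_le_trans /[apply]]; rewrite ltNge ba.
have Aa : A a.
  split; first exact: ltW.
  by move=> s /andP[/lt_le_trans /[apply]]; rewrite ltxx.
have ubA : has_ubound A by exists b => t [].
have supA : has_sup A by split => //; exists a.
have Ab : sup A <= b by apply: ge_sup; [exists a|move=> t []].
have aS : a <= sup A by exact: (ub_le_sup ubA).
have below s i : a < s < sup A -> 0 < f i s.
  case/andP=> as_ sS.
  have [t [tb At] st] : exists2 t, A t & s < t.
    have e0 : 0 < sup A - s by rewrite subr_gt0.
    by have [t At] := sup_adherent e0 supA; rewrite subKr; exists t.
  by apply: At; rewrite as_ ltW.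
have atS : a < sup A -> forall i, 0 < f i (sup A).
  move=> {}aS.
  have aSb : a < sup A <= b by rewrite aS.
  have ge0 j : 0 <= f j (sup A).
    rewrite leNgt; apply/negP => fneg.
    have H := cvgr_lt _ (cvg_at_left_filter (fc j _ aSb)) _ fneg.
    near (sup A)^'- => s.
    have /(below _ j) : a < s < sup A.
      apply/andP; split; near: s; first exact: nbhs_left_gt.
      exact: nbhs_left_lt.
    by rewrite ltNge => /negP; apply; apply/ltW; near: s; exact: H.
  move=> i; rewrite lt_neqAle ge0 andbT eq_sym; apply/negP => /eqP fi0.
  have [d /is_derive_near_lt/[apply] H] := fd i _ aSb ge0 fi0.
  near (sup A)^'- => s.
  have /(below _ i) : a < s < sup A.
    apply/andP; split; near: s; first exact: nbhs_left_gt.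
    exact: nbhs_left_lt.
  by rewrite ltNge => /negP; apply; rewrite -fi0 ltW//; near: s; exact: H.
suff SbE : sup A = b.
  move=> t i /andP[at_]; rewrite le_eqVlt -SbE => /orP[/eqP ->|tS].
    by apply: atS; rewrite SbE.
  by apply: below; rewrite at_.
apply/eqP; rewrite eq_le Ab /= leNgt; apply/negP => Sb.
(* Positivity extends beyond [sup A]: by the initial hypothesis if [sup A = a], by continuity
   otherwise. *)
have nearS : \forall t \near (sup A)^'+, forall i, 0 < f i t.
  apply: filter_forall => i.
  move: aS; rewrite le_eqVlt => /orP[/eqP <-//|aS].
  have aSb : a < sup A <= b by rewrite aS.
  exact: (cvgr_gt _ (cvg_at_right_filter (fc i _ aSb)) _ (atS aS i)).
move: nearS => /nbhs_ballP[e /= e0 He].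
pose t := Num.min b (sup A + e / 2).
have St : sup A < t by rewrite lt_min Sb ltrDl divr_gt0.
have At : A t.
  split; first by rewrite ge_min lexx.
  move=> s /andP[as_ st] i.
  have [sS|Ss|sE] := ltgtP s (sup A).
  - by apply: below; rewrite as_.
  - apply: He => //; rewrite /ball/= distrC gtr0_norm ?subr_gt0//.
    rewrite ltrBlDl (le_lt_trans st)// gt_min; apply/orP; right.
    by rewrite ltrD2l; lra.
  - by rewrite sE; apply: atS; rewrite -sE.
by have := ub_le_sup ubA At; rewrite leNgt St.
Unshelve. all: by end_near. Qed.

End Barrier.

(** * Equilibria *)

Lemma fin_pos_lbound {R : realType} {I : finType} (f : I -> R) :
  (forall i, 0 < f i) -> exists2 c, 0 < c & forall i, c <= f i.
Proof.
move=> f0; exists (\big[Order.min/1]_i f i); last by move=> i; exact: bigmin_le.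
by apply/bigmin_gtP; split.
Qed.

Lemma fin_ubound {R : realType} {I : finType} (f : I -> R) :
  exists2 c, 0 < c & forall i, f i <= c.
Proof.
exists (1 + \sum_i `|f i|).
  by rewrite ltr_pwDl// sumr_ge0.
move=> i; rewrite (le_trans (ler_norm _))// (bigD1 i)//= addrCA lerDl.
by rewrite addr_ge0// sumr_ge0.
Qed.

Lemma powR_gt1 {R : realType} (p r : R) : 0 < p -> 1 < r -> 1 < r `^ p.
Proof.
move=> p0 r1; have := @gt0_ltr_powR R p p0 1 r.
by rewrite powR1; apply => //; rewrite nnegrE ltW// (lt_trans ltr01).
Qed.

Section Field.
Context {R : realType} {N : nat}.
Variables (th m : 'I_N -> R) (s p : R).

(** The factor [c] weighs the power term: [c = 1] is (OY), while a time-dependent [c] tending to 1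
    arises from (OV). *)
Definition field_OY (c : R) (y : 'I_N -> R) (i : 'I_N) : R :=
  \sum_(k < N) m k * (y k - y i) + s * (th i - c * y i `^ p) * y i.

Hypotheses (th0 : forall i, 0 < th i) (m0 : forall i, 0 < m i).
Hypotheses (s0 : 0 < s) (p0 : 0 < p).

(** Cooperativity (the Kamke condition): the other coordinates enter with the positive weights
    [m k]. *)
Lemma field_OY_mono c y y' i : (forall k, y k <= y' k) -> y i = y' i ->
  field_OY c y i <= field_OY c y' i.
Proof.
move=> yy' yi; rewrite /field_OY yi lerD2r ler_sum// => k _.
by rewrite ler_wpM2l ?lerD2r // ltW.
Qed.

Lemma field_OY_scale c r z i : 0 < r -> 0 < z i ->
  field_OY c (fun k => r * z k) i =
  r * (field_OY 1 z i + s * (1 - c * r `^ p) * z i `^ p * z i).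
Proof.
move=> r0 zi0; rewrite /field_OY powRM ?ltW//.
under eq_bigr do rewrite -mulrBr mulrCA.
by rewrite -mulr_sumr; ring.
Qed.

Lemma field_OY_scale_le c r w z i : 0 < r -> 0 < z i ->
  (forall k, w k <= r * z k) -> w i = r * z i ->
  field_OY c w i <=
  r * (field_OY 1 z i + s * (1 - c * r `^ p) * z i `^ p * z i).
Proof. by move=> r0 zi0 wz wi; rewrite -field_OY_scale// field_OY_mono. Qed.

Lemma field_OY_scale_ge c r w z i : 0 < r -> 0 < z i ->
  (forall k, r * z k <= w k) -> w i = r * z i ->
  r * (field_OY 1 z i + s * (1 - c * r `^ p) * z i `^ p * z i) <=
  field_OY c w i.
Proof. by move=> r0 zi0 wz wi; rewrite -field_OY_scale// field_OY_mono. Qed.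

Lemma max_ratio (y z : 'I_N -> R) (i0 : 'I_N) :
  (forall i, 0 < y i) -> (forall i, 0 < z i) ->
  exists r i, [/\ 0 < r, forall k, y k <= r * z k & y i = r * z i].
Proof.
move=> y0 z0; pose i := [arg max_(j > i0) (y j / z j)]%O.
exists (y i / z i), i; split; first by rewrite divr_gt0.
- move=> k; rewrite -ler_pdivrMr// /i.
  by case: arg_maxP => // j _; apply.
- by rewrite divfK// gt_eqF.
Qed.

(** Let [r z] be the least multiple of [z] above [y]. If [r > 1], then where they touch
    cooperativity bounds the field of [y] by that of [r z], which is negative. *)
Lemma subsol_le_supersol (y z : 'I_N -> R) :
  (forall i, 0 < y i) -> (forall i, 0 < z i) ->
  (forall i, 0 <= field_OY 1 y i) -> (forall i, field_OY 1 z i <= 0) ->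
  forall i, y i <= z i.
Proof.
move=> y0 z0 Fy Fz i0.
have [r [i [r0 yz yi]]] := max_ratio i0 y0 z0.
have [r1|r1] := leP r 1.
  by rewrite (le_trans (yz i0))// ger_pMl.
have := le_trans (Fy i) (field_OY_scale_le 1 r0 (z0 i) yz yi).
rewrite pmulr_rge0// leNgt => /negP[].
rewrite ltr_wnDl// mul1r -mulrA nmulr_rlt0.
  by rewrite mulr_gt0 ?powR_gt0.
by rewrite pmulr_rlt0// subr_lt0 powR_gt1.
Qed.

(** At a largest coordinate the coupling is nonpositive, so there [y i] to the power [p] cannot
    exceed [th i]. *)
Lemma subsol_ubound : exists2 B, 0 < B &
  forall y, (forall i, 0 < y i) -> (forall i, 0 <= field_OY 1 y i) ->
  forall i, y i <= B.
Proof.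
have [C C0 Cth] := fin_ubound th.
exists (C `^ p^-1); first exact: powR_gt0.
move=> y y0 Fy i0; pose i := [arg max_(j > i0) y j]%O.
have ymax k : y k <= y i by rewrite /i; case: arg_maxP => // j _; apply.
rewrite (le_trans (ymax i0))// leNgt; apply/negP => Cy.
have := Fy i; rewrite leNgt => /negP; apply.
rewrite /field_OY mul1r ltr_wnDl//.
  by apply: sumr_le0 => k _; apply: mulr_ge0_le0; rewrite ?subr_le0// ltW.
rewrite nmulr_rlt0// pmulr_rlt0// subr_lt0 (le_lt_trans (Cth i))//.
have -> : C = (C `^ p^-1) `^ p.
  by rewrite -powRrM mulVf ?gt_eqF// powRr1// ltW.
by apply: gt0_ltr_powR => //; rewrite nnegrE ?powR_ge0 ?ltW.
Qed.

Lemma subsol_ex : exists y, (forall i, 0 < y i) /\ (forall i, 0 <= field_OY 1 y i).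
Proof.
have [c c0 cth] := fin_pos_lbound th0.
(* A vector with equal coordinates feels no coupling; [c] is a lower bound of the [th i]. *)
exists (fun=> c `^ p^-1); split => i; first exact: powR_gt0.
rewrite /field_OY big1 ?add0r; last by move=> k _; rewrite subrr mulr0.
rewrite mul1r mulr_ge0 ?powR_ge0// mulr_ge0//; first exact: ltW.
by rewrite subr_ge0 -powRrM mulVf ?gt_eqF// powRr1// ltW.
Qed.

(** Every neighbour, [i] included, is frozen at [y], and only the driven coordinate moves to [t]. By
    cooperativity this dominates the field at vectors below [y] with [i]-th coordinate [t], and is
    dominated by it at such vectors above [y]. *)
Let phi (y : 'I_N -> R) (i : 'I_N) (t : R) :=
  \sum_(k < N) m k * (y k - t) + s * (th i - 1 * t `^ p) * t.

Let phi_continuous y i t : 0 < t -> {for t, continuous (phi y i)}.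
Proof.
move=> t0; have pd := is_derive1_powR p t0.
apply: is_derive_continuous.
apply: is_deriveD_fun.
by apply: is_derive_sum_fun => k; apply: is_deriveZ_fun.
Qed.

(** Perron's method: the supremum [Y] of the positive subsolutions is again a subsolution, and a
    strict inequality in one coordinate would leave room to raise it. *)
Lemma equilibrium_ex : exists y, (forall i, 0 < y i) /\
  (forall i, field_OY 1 y i = 0).
Proof.
pose A := [set y : 'I_N -> R | (forall i, 0 < y i) /\
                               (forall i, 0 <= field_OY 1 y i)].
have [B B0 AB] := subsol_ubound.
have [a Aa] : A !=set0 by have [a] := subsol_ex; exists a.
pose Ai i := [set y i | y in A].
pose Y i := sup (Ai i).
have ubAi i : has_ubound (Ai i) by exists B => _ [y [y0 Fy] <-]; exact: AB.
have supAi i : has_sup (Ai i) by split => //; exists (a i), a.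
have AY y i : A y -> y i <= Y i by move=> Ay; apply: ub_le_sup => //; exists y.
have Y0 i : 0 < Y i by rewrite (lt_le_trans (Aa.1 i))// AY.
have FY i : 0 <= field_OY 1 Y i.
  rewrite leNgt; apply/negP => FYneg.
  have : \forall t \near Y i, phi Y i t < 0.
    exact: (cvgr_lt _ (@phi_continuous Y i _ (Y0 i)) _ FYneg).
  move=> /nbhs_ballP[e /= e0 He].
  have [_ [y Ay <-] yY] := sup_adherent e0 (supAi i).
  have : phi Y i (y i) < 0.
    apply: He; rewrite /ball/= ger0_norm ?subr_ge0 ?AY//.
    by rewrite ltrBlDl -ltrBlDr.
  apply/negP; rewrite -leNgt (le_trans (Ay.2 i))// lerD2r ler_sum// => k _.
  by rewrite ler_wpM2l ?lerD2r ?AY // ltW.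
exists Y; split => // i; apply/eqP; rewrite eq_le FY andbT leNgt; apply/negP.
move=> FYpos.
have : \forall t \near Y i, 0 < phi Y i t.
  exact: (cvgr_gt _ (@phi_continuous Y i _ (Y0 i)) _ FYpos).
move=> /nbhs_ballP[e /= e0 He].
(* Raising coordinate [i] alone by [e / 2] keeps a subsolution: the other components of the field
   only gain by cooperativity. *)
pose t := Y i + e / 2.
have Yt : Y i < t by rewrite ltrDl divr_gt0.
pose Y' k := if k == i then t else Y k.
have YY' k : Y k <= Y' k by rewrite /Y'; case: eqP => // ->; exact: ltW.
have AY' : A Y'.
  split=> j; first exact: lt_le_trans (YY' j).
  have [ji|ji] := eqVneq j i; last first.
    rewrite (le_trans (FY j))// field_OY_mono//.
    by rewrite /Y' (negbTE ji).
  have Y'i : Y' j = t by rewrite /Y' ji eqxx.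
  have phit : 0 < phi Y i t.
    apply: He; rewrite /ball/= distrC gtr0_norm ?subr_gt0//.
    by rewrite /t addrAC subrr add0r; lra.
  rewrite (le_trans (ltW phit))// /field_OY Y'i ji lerD2r ler_sum// => k _.
  by rewrite ler_wpM2l ?lerD2r // ltW.
by have := AY _ i AY'; rewrite {1}/Y' eqxx leNgt Yt.
Qed.

Lemma equilibrium_uniq y z : (forall i, 0 < y i) -> (forall i, 0 < z i) ->
  (forall i, field_OY 1 y i = 0) -> (forall i, field_OY 1 z i = 0) ->
  forall i, y i = z i.
Proof.
move=> y0 z0 Fy Fz i; apply/eqP; rewrite eq_le.
by apply/andP; split; apply: subsol_le_supersol => // j; rewrite ?Fy ?Fz.
Qed.

End Field.

(** * Barriers proportional to an equilibrium *)

Section Exponential.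
Context {R : realType}.
Implicit Types (r p A l t : R).

(** Two tangent inequalities combine: [r^p >= 1 + p ln r] and [ln r >= 1 - 1/r]. The result bounds
    the relaxation rate of a barrier by a linear function of [r - 1]. *)
Lemma powR_bernoulli r p : 0 < p -> 0 < r -> p * (r - 1) <= r * (r `^ p - 1).
Proof.
move=> p0 r0.
have h : 1 + p * ln r <= r `^ p by rewrite /powR gt_eqF// expR_ge1Dx.
have lnr : 1 - r^-1 <= ln r.
  have := @le_ln1Dx R (r^-1 - 1); rewrite addrCA subrr addr0 lnV ?posrE//.
  have : -1 < r^-1 - 1 by rewrite ltrBrDr addrC subrr invr_gt0.
  by move=> /[swap] /[apply]; lra.
have : p * (1 - r^-1) <= r `^ p - 1 by have := ler_wpM2l (ltW p0) lnr; lra.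
move=> /(ler_wpM2l (ltW r0)); apply: le_trans.
by rewrite mulrCA (mulrBr r) mulr1 divff ?gt_eqF.
Qed.

Lemma powR_bernoulli_inv r p : 0 < p -> 0 < r ->
  p * (1 - r) * r `^ p <= 1 - r `^ p.
Proof.
move=> p0 r0; have ri0 : 0 < r^-1 by rewrite invr_gt0.
have := powR_bernoulli p0 ri0.
move=> /(ler_wpM2l (ltW r0)); rewrite (mulrA r r^-1) divff ?gt_eqF// mul1r.
have -> : r^-1 `^ p = (r `^ p)^-1.
  by rewrite -powRN -[r^-1]powR_inv1 ?ltW// -powRrM mulN1r.
have rp0 : 0 < r `^ p by exact: powR_gt0.
move=> /(ler_wpM2r (ltW rp0)); rewrite mulrBl mulVf ?gt_eqF// mul1r.
apply: le_trans; rewrite ler_pM2r// mulrCA (mulrBr r) mulr1 divff ?(gt_eqF r0)//.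
Qed.

Lemma is_derive_expdecay d A l t0 t :
  is_derive t 1 (fun t => d + A * expR (- l * (t - t0)))
    (- l * (A * expR (- l * (t - t0)))).
Proof.
apply: is_derive_eq.
by rewrite /GRing.scale/=; ring.
Qed.

Lemma near_expdecay_lt A l t0 e : 0 < l -> 0 < e ->
  \forall t \near +oo, A * expR (- l * (t - t0)) < e.
Proof.
move=> l0 e0; near=> t.
have tt0 : t0 < t by near: t; apply: nbhs_pinfty_gt; exact: num_real.
have ltt0 : 0 < l * (t - t0) by rewrite mulr_gt0// subr_gt0.
rewrite mulNr expRN ltr_pdivrMr ?expR_gt0//.
apply: (@lt_le_trans _ _ (e * (1 + l * (t - t0)))); last first.
  by rewrite ler_pM2l// expR_ge1Dx.
rewrite -ltr_pdivrMl// -ltrBlDl -ltr_pdivrMl// -ltrBlDr opprK.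
by near: t; apply: nbhs_pinfty_gt; exact: num_real.
Unshelve. all: by end_near. Qed.

End Exponential.

Lemma near_lt_cvg {R : realType} {T : Type} (F : set_system T) {FF : Filter F}
    (f g : T -> R) (a b : R) :
  f @ F --> a -> g @ F --> b -> a < b -> \forall t \near F, f t < g t.
Proof.
move=> fa gb ab; have ab0 : 0 < b - a by rewrite subr_gt0.
near=> t; rewrite -subr_gt0; near: t.
exact: (cvgr_gt _ (cvgB gb fa) _ ab0).
Unshelve. all: by end_near. Qed.

Section Perturbed.
Context {R : realType} {N : nat}.
Variables (th m : 'I_N -> R) (s p : R).
Hypotheses (th0 : forall i, 0 < th i) (m0 : forall i, 0 < m i).
Hypotheses (s0 : 0 < s) (p0 : 0 < p).
Variable z : 'I_N -> R.
Hypotheses (z0 : forall i, 0 < z i) (Fz : forall i, field_OY th m s p 1 z i = 0).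

Section Barriers.
Variables (w c : 'I_N -> R -> R) (r r' : R -> R) (a b : R).
Hypothesis dw : forall i t, a < t <= b ->
  is_derive t 1 (w i) (field_OY th m s p (c i t) (w^~ t) i).
Hypothesis dr : forall t, a < t <= b -> is_derive t 1 r (r' t).
Hypothesis r0 : forall t, a < t <= b -> 0 < r t.

(** At a first contact [w j = r z j], cooperativity bounds the field of [w] by that of [r z], which
    the scaling identity computes since [z] is an equilibrium. The condition on [r'] says that [r z]
    is a strict supersolution. *)
Lemma upper_barrier :
  (forall i, \forall t \near a^'+, w i t < r t * z i) ->
  (forall i t, a < t <= b ->
     s * (1 - c i t * r t `^ p) * z i `^ p * r t < r' t) ->
  forall t i, a < t <= b -> w i t < r t * z i.
Proof.
move=> wa hr t i tab; rewrite -subr_gt0.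
have df j u : a < u <= b -> is_derive u 1 (fun u => r u * z j - w j u)
    (z j * r' u - field_OY th m s p (c j u) (w^~ u) j).
  move=> uab.
  have := is_deriveB_fun (is_deriveM_fun (dr uab) (is_derive_cst (z j) u 1))
    (dw j uab).
  by rewrite mulr0 add0r.
apply: (barrier (f := fun i t => r t * z i - w i t) (a := a) (b := b)) => //.
- move=> j; move: (wa j); apply: filterS => u.
  by rewrite subr_gt0.
- by move=> j u /(df j); exact: is_derive_continuous.
- move=> j u uab wz /eqP; rewrite subr_eq0 => /eqP wj.
  exists (z j * r' u - field_OY th m s p (c j u) (w^~ u) j); first exact: df.
  rewrite subr_gt0.
  have := @field_OY_scale_le _ _ th m s p m0 (c j u) (r u) (w^~ u) z j (r0 uab)
    (z0 j).
  move=> /(_ (fun k => _)) H; apply: le_lt_trans; first apply: H => //.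
    by move=> k; have := wz k; rewrite subr_ge0.
  rewrite Fz add0r mulrA [ltLHS]mulrC ltr_pM2l//.
  by rewrite mulrC hr.
Qed.

Lemma lower_barrier :
  (forall i, \forall t \near a^'+, r t * z i < w i t) ->
  (forall i t, a < t <= b ->
     r' t < s * (1 - c i t * r t `^ p) * z i `^ p * r t) ->
  forall t i, a < t <= b -> r t * z i < w i t.
Proof.
move=> wa hr t i tab; rewrite -subr_gt0.
have df j u : a < u <= b -> is_derive u 1 (fun u => w j u - r u * z j)
    (field_OY th m s p (c j u) (w^~ u) j - z j * r' u).
  move=> uab.
  have := is_deriveB_fun (dw j uab)
    (is_deriveM_fun (dr uab) (is_derive_cst (z j) u 1)).
  by rewrite mulr0 add0r.
apply: (barrier (f := fun i t => w i t - r t * z i) (a := a) (b := b)) => //.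
- move=> j; move: (wa j); apply: filterS => u.
  by rewrite subr_gt0.
- by move=> j u /(df j); exact: is_derive_continuous.
- move=> j u uab wz /eqP; rewrite subr_eq0 => /eqP wj.
  exists (field_OY th m s p (c j u) (w^~ u) j - z j * r' u); first exact: df.
  rewrite subr_gt0.
  have := @field_OY_scale_ge _ _ th m s p m0 (c j u) (r u) (w^~ u) z j (r0 uab)
    (z0 j).
  move=> /(_ (fun k => _)) H; apply: lt_le_trans; last apply: H => //.
    rewrite Fz add0r mulrA [ltRHS]mulrC ltr_pM2l//.
    by rewrite [ltRHS]mulrC hr.
  by move=> k; have := wz k; rewrite subr_ge0.
Qed.

End Barriers.

(** The barriers [(1 + A exp(-l t)) z] and [(1 - A exp(-l t)) z] enclose the solution. With
    [A <= 1/2] the lower factor stays at least 1/2, so one rate [l] serves all solutions and all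
    horizons [b]. *)
Lemma equilibrium_exp_attracts : exists2 l : R, 0 < l &
  forall (w : 'I_N -> R -> R) (b A : R), 0 < A <= 2^-1 ->
  (forall i (t : R), 0 < t <= b ->
     is_derive t 1 (w i) (field_OY th m s p 1 (w^~ t) i)) ->
  (forall i, w i t @[t --> 0^'+] --> w i 0) ->
  (forall i, `|w i 0 - z i| < A * z i) ->
  forall t i, 0 < t <= b -> `|w i t - z i| < A * expR (- l * t) * z i.
Proof.
have [mu mu0 zmu] := fin_pos_lbound (fun i => powR_gt0 p (z0 i)).
pose h := 2^-1 `^ p : R.
have h0 : 0 < h by rewrite powR_gt0.
have h1 : h <= 1.
  rewrite /h -[leRHS](powRr0 (2^-1 : R)); apply: ger_powR; last exact: ltW.
  by apply/andP; split; lra.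
(* On the lower barrier [h] bounds [r^p] below and 1/2 bounds [r] below; the further factor 1/2
   makes the inequality strict. *)
exists (s * mu * p * h / 4).
  by rewrite !mulr_gt0.
set l := _ / 4 => w b A /andP[A0 A2] dw w0 wz t i tb.
rewrite -[X in expR (_ * X)]subr0.
have smp : 0 < s * mu * p by rewrite !mulr_gt0.
have l0 : 0 < l by rewrite !mulr_gt0.
have lle : l < s * mu * p by rewrite /l; nra.
have e1 u : 0 < u -> expR (- l * u) <= 1.
  by move=> u0; rewrite -expR0 ler_expR; nra.
have cvr B : (fun t => 1 + B * expR (- l * (t - 0))) @ 0^'+ --> 1 + B.
  have := is_derive_expdecay 1 B l 0 (0 : R).
  move=> /is_derive_continuous/cvg_at_right_filter.
  by rewrite subrr mulr0 expR0 mulr1.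
have up : w i t < (1 + A * expR (- l * (t - 0))) * z i.
  apply: (@upper_barrier w (fun _ _ => 1) (fun t => 1 + A * expR (- l * (t - 0)))
    (fun t => - l * (A * expR (- l * (t - 0)))) 0 b) => //.
  - by move=> u _; exact: is_derive_expdecay.
  - by move=> u _; rewrite addr_gt0// mulr_gt0// expR_gt0.
  - move=> j; apply: (near_lt_cvg (w0 j) (cvgM (cvr A) (cvg_cst (z j)))).
    by have := wz j; rewrite ltr_norml => /andP[_]; lra.
  - move=> j u /andP[u0 ub]; set e := expR _.
    have e0 : 0 < e by exact: expR_gt0.
    have r0 : 0 < 1 + A * e by rewrite addr_gt0// mulr_gt0.
    have := powR_bernoulli p0 r0.
    rewrite mul1r; move: (_ `^ p) (z j `^ p) (zmu j) => q zp mzp.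
    have Ae : 0 < A * e by rewrite mulr_gt0.
    move: (A * e) Ae r0 => E E0 r0 Hq.
    have Hq2 : p * E <= (1 + E) * (q - 1) by lra.
    suff : l * E < s * zp * ((1 + E) * (q - 1)) by lra.
    apply: (@lt_le_trans _ _ (s * mu * (p * E))); first by nra.
    by apply: ler_pM; rewrite ?ler_pM2l//; apply: mulr_ge0; apply: ltW.
have lo : (1 + (- A) * expR (- l * (t - 0))) * z i < w i t.
  have r2 (u : R) : 0 < u <= b ->
      2^-1 <= 1 + (- A) * expR (- l * (u - 0)).
    move=> /andP[u0 _]; rewrite subr0; have := e1 u u0.
    by have := expR_gt0 (- l * u); move: (expR _) => e; nra.
  apply: (@lower_barrier w (fun _ _ => 1)
    (fun t => 1 + (- A) * expR (- l * (t - 0)))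
    (fun t => - l * ((- A) * expR (- l * (t - 0)))) 0 b) => //.
  - by move=> u _; exact: is_derive_expdecay.
  - by move=> u /r2; apply: lt_le_trans; rewrite invr_gt0.
  - move=> j; apply: (near_lt_cvg (cvgM (cvr (- A)) (cvg_cst (z j))) (w0 j)).
    by have := wz j; rewrite ltr_norml => /andP[+ _]; lra.
  - move=> j u ub; have := r2 _ ub; set e := expR _ => e2.
    have e0 : 0 < e by exact: expR_gt0.
    have r0 : 0 < 1 + - A * e by apply: lt_le_trans e2; lra.
    have hq : h <= (1 + - A * e) `^ p.
      by apply: (ge0_ler_powR (ltW p0)); rewrite ?nnegrE; lra.
    have := powR_bernoulli_inv p0 r0.
    rewrite mul1r; move: (_ `^ p) hq (z j `^ p) (zmu j) => q hq zp mzp.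
    have Ae : 0 < A * e by rewrite mulr_gt0.
    rewrite mulNr in e2 r0 *; move: (A * e) Ae e2 r0 => E E0 e2 r0 Hq.
    have Hq2 : p * E * h <= 1 - q.
      apply: le_trans Hq; rewrite opprB addrCA subrr addr0.
      by rewrite ler_pM2l// mulr_gt0.
    suff : l * E < s * zp * ((1 - q) * (1 - E)) by lra.
    apply: (@lt_le_trans _ _ (s * mu * (p * E * h * 2^-1))).
      rewrite /l; have : 0 < s * mu * p * h * E by rewrite !mulr_gt0.
      by lra.
    have peh : 0 <= p * E * h by apply: ltW; rewrite !mulr_gt0.
    apply: ler_pM.
    - by apply: mulr_ge0; apply: ltW.
    - by apply: mulr_ge0; rewrite // invr_ge0.
    - by rewrite ler_pM2l.
    - by apply: ler_pM => //; rewrite ?invr_ge0//; lra.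
by rewrite ltr_norml; apply/andP; split; lra.
Qed.

End Perturbed.

(** * Convergence under a vanishing perturbation of the power term *)

Section Asymptotic.
Context {R : realType} {N : nat}.
Variables (th m : 'I_N -> R) (s p : R).
Hypotheses (m0 : forall i, 0 < m i) (s0 : 0 < s) (p0 : 0 < p).
Variable z : 'I_N -> R.
Hypotheses (z0 : forall i, 0 < z i) (Fz : forall i, field_OY th m s p 1 z i = 0).
Variables (w c : 'I_N -> R -> R).
Hypotheses (w0 : forall i (t : R), 0 < t -> 0 < w i t).
Hypothesis dw : forall i (t : R), 0 < t ->
  is_derive t 1 (w i) (field_OY th m s p (c i t) (w^~ t) i).
Hypothesis c1 : forall i, c i @ +oo --> (1 : R).

(** The barrier factor falls from above all ratios [w i / z i] at a time [t0] towards [1 + d / 2].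
    Past [t0] the [c j] are close enough to 1 for [c j * r^p] to exceed 1 by the fixed margin
    [ga]. *)
Lemma perturbed_near_lt (d : R) (i : 'I_N) : 0 < d ->
  \forall t \near +oo, w i t < (1 + d) * z i.
Proof.
move=> d0.
have [mu mu0 zmu] := fin_pos_lbound (fun i => powR_gt0 p (z0 i)).
pose g := (1 + d / 2) `^ p.
have g1 : 1 < g by apply: powR_gt1 => //; lra.
have g0 : 0 < g by lra.
pose ga := (g - 1) / 2.
have ga0 : 0 < ga by rewrite /ga; lra.
have cg : \forall t \near +oo, forall j, (1 + ga) / g < c j t.
  apply: filter_forall => j; apply: (cvgr_gt _ (c1 j)).
  by rewrite ltr_pdivrMr// /ga; lra.
have [t0 [/= t0gt0 t0c]] : exists t0 : R, 0 < t0 /\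
    forall t : R, t0 <= t -> forall j, (1 + ga) / g < c j t.
  have [M [_ HM]] := cg; exists (Num.max 1 (M + 1)); split.
    by rewrite lt_max ltr01.
  move=> t; rewrite ge_max => /andP[_ Mt]; apply: HM.
  by rewrite (lt_le_trans _ Mt)// ltrDl.
have [A A0 wA] := fin_ubound (fun i => w i t0 / z i).
have smg : 0 < s * mu * ga by apply: mulr_gt0 => //; exact: mulr_gt0.
pose l := s * mu * ga / 2.
have l0 : 0 < l by exact: divr_gt0.
pose r t := (1 + d / 2) + A * expR (- l * (t - t0)).
have rA t : 0 < A * expR (- l * (t - t0)) by rewrite mulr_gt0// expR_gt0.
near=> t.
have tt0 : t0 < t by near: t; apply: nbhs_pinfty_gt; exact: num_real.
apply: (@lt_trans _ _ (r t * z i)); last first.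
  rewrite ltr_pM2r// /r.
  have : A * expR (- l * (t - t0)) < d / 2.
    by near: t; apply: near_expdecay_lt => //; lra.
  by lra.
apply: (@upper_barrier _ _ th m s p m0 _ z0 Fz w c r
  (fun t => - l * (A * expR (- l * (t - t0)))) t0 t).
- by move=> j u /andP[t0u _]; apply: dw; exact: lt_trans t0u.
- by move=> u _; exact: is_derive_expdecay.
- by move=> u _; rewrite /r; have := rA u; lra.
- move=> j; apply: (near_lt_cvg (a := w j t0) (b := r t0 * z j)).
  + by apply: cvg_at_right_filter; exact: is_derive_continuous (dw j t0gt0).
  + apply: cvgM (cvg_cst _); apply: cvg_at_right_filter.
    exact: is_derive_continuous (is_derive_expdecay _ _ _ _ _).
  + rewrite /r subrr mulr0 expR0 mulr1 -ltr_pdivrMr//.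
    by rewrite (le_lt_trans (wA j))//; lra.
- move=> j u /andP[t0u _].
  have := t0c _ (ltW t0u) j; rewrite ltr_pdivrMr// => cgu.
  have gr : g <= r u `^ p.
    by apply: (ge0_ler_powR (ltW p0)); rewrite ?nnegrE /r; have := rA u; lra.
  have cr : 1 + ga < c j u * r u `^ p.
    apply: (lt_le_trans cgu); rewrite ler_pM2l//.
    by rewrite -(pmulr_lgt0 _ g0); lra.
  move: (_ * r u `^ p) cr (z j `^ p) (zmu j) => q gq zp mzp.
  have := rA u; rewrite /r; move: (A * _) => E E0.
  suff : l * E < s * zp * ((q - 1) * (1 + d / 2 + E)) by lra.
  apply: (@lt_le_trans _ _ (s * mu * (ga * (1 + d / 2 + E)))).
    by rewrite /l; nra.
  apply: ler_pM.
  - by apply: mulr_ge0; apply: ltW.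
  - by apply: mulr_ge0; lra.
  - by rewrite ler_pM2l.
  - by rewrite ler_pM2r; lra.
- by rewrite tt0 lexx.
Unshelve. all: by end_near. Qed.

(** Mirror image with a factor rising towards [1 - d / 2]. It must start from some [be > 0] below
    all ratios at [t0], which positivity of [w] provides, and its speed is limited by [be], a lower
    bound of [r]. *)
Lemma perturbed_near_gt (d : R) (i : 'I_N) : 0 < d < 1 ->
  \forall t \near +oo, (1 - d) * z i < w i t.
Proof.
move=> /andP[d0 d1].
have [mu mu0 zmu] := fin_pos_lbound (fun i => powR_gt0 p (z0 i)).
pose g := (1 - d / 2) `^ p.
have g0 : 0 < g by rewrite powR_gt0//; lra.
have g1 : g < 1.
  have : 1 < (1 - d / 2)^-1 `^ p.
    by apply: powR_gt1 => //; rewrite invf_gt1; lra.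
  rewrite -powR_inv1; last by lra.
  by rewrite powRAC powR_inv1 ?(ltW g0)// invf_gt1.
pose ga := (1 - g) / 2.
have ga0 : 0 < ga by rewrite /ga; lra.
have cg : \forall t \near +oo, forall j, c j t < (1 - ga) / g.
  apply: filter_forall => j; apply: (cvgr_lt _ (c1 j)).
  by rewrite ltr_pdivlMr// /ga; lra.
have [t0 [/= t0gt0 t0c]] : exists t0 : R, 0 < t0 /\
    forall t : R, t0 <= t -> forall j, c j t < (1 - ga) / g.
  have [M [_ HM]] := cg; exists (Num.max 1 (M + 1)); split.
    by rewrite lt_max ltr01.
  move=> t; rewrite ge_max => /andP[_ Mt]; apply: HM.
  by rewrite (lt_le_trans _ Mt)// ltrDl.
have [be' be'0 wbe'] := fin_pos_lbound
  (fun i => divr_gt0 (w0 i t0gt0) (z0 i)).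
pose be := Num.min (be' / 2) (2^-1 * (1 - d / 2)).
have be0 : 0 < be by rewrite lt_min; apply/andP; split; lra.
have beb : be < be' by rewrite gt_min; apply/orP; left; lra.
have bed : be < 1 - d / 2 by rewrite gt_min; apply/orP; right; lra.
pose B := 1 - d / 2 - be.
have B0 : 0 < B by rewrite /B; lra.
have smgb : 0 < s * mu * ga * be.
  by apply: mulr_gt0 => //; apply: mulr_gt0 => //; exact: mulr_gt0.
pose l := s * mu * ga * be / 2.
have l0 : 0 < l by exact: divr_gt0.
pose r t := (1 - d / 2) + (- B) * expR (- l * (t - t0)).
have rB t : 0 < B * expR (- l * (t - t0)) by rewrite mulr_gt0// expR_gt0.
have rB1 t : t0 < t -> B * expR (- l * (t - t0)) <= B.
  move=> tt0; rewrite ger_pMr// -expR0 ler_expR mulNr oppr_le0.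
  by rewrite mulr_ge0// ?subr_ge0 ltW.
near=> t.
have tt0 : t0 < t by near: t; apply: nbhs_pinfty_gt; exact: num_real.
apply: (@lt_trans _ _ (r t * z i)).
  rewrite ltr_pM2r// /r.
  have : B * expR (- l * (t - t0)) < d / 2.
    by near: t; apply: near_expdecay_lt => //; lra.
  by lra.
have rbe u : t0 < u -> be <= r u.
  by move=> /rB1; rewrite /r /B; lra.
apply: (@lower_barrier _ _ th m s p m0 _ z0 Fz w c r
  (fun t => - l * ((- B) * expR (- l * (t - t0)))) t0 t).
- by move=> j u /andP[t0u _]; apply: dw; exact: lt_trans t0u.
- by move=> u _; exact: is_derive_expdecay.
- by move=> u /andP[/rbe + _]; exact: lt_le_trans.
- move=> j; apply: (near_lt_cvg (b := w j t0) (a := r t0 * z j)).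
  + apply: cvgM (cvg_cst _); apply: cvg_at_right_filter.
    exact: is_derive_continuous (is_derive_expdecay _ _ _ _ _).
  + by apply: cvg_at_right_filter; exact: is_derive_continuous (dw j t0gt0).
  + rewrite /r subrr mulr0 expR0 mulr1 -ltr_pdivlMr//.
    by rewrite (lt_le_trans _ (wbe' j))// /B; lra.
- move=> j u /andP[t0u _].
  have := t0c _ (ltW t0u) j; rewrite ltr_pdivlMr// => cgu.
  have rg : r u `^ p <= g.
    apply: (ge0_ler_powR (ltW p0)); rewrite ?nnegrE; have := rB u;
      have := rbe u t0u; rewrite /r; lra.
  have r0 := powR_ge0 (r u) p.
  have cr : c j u * r u `^ p <= 1 - ga.
    (* The sign of [c j u] is unknown here; a nonpositive value satisfies the bound at once. *)
    have [cneg|cpos] := leP (c j u) 0.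
      apply: (@le_trans _ _ 0); last by rewrite /ga; lra.
      by rewrite mulr_le0_ge0.
    by apply: ltW; apply: le_lt_trans cgu; rewrite ler_pM2l.
  have := rB1 u t0u; have := rB u; have := rbe u t0u.
  move: (_ * r u `^ p) cr (z j `^ p) (zmu j) => q gq zp mzp.
  move: (r u) => ru beru; rewrite (mulNr B) mulrNN.
  move: (B * _) => E E0 EB.
  suff : l * E < s * zp * ((1 - q) * ru) by lra.
  apply: (@lt_le_trans _ _ (s * mu * (ga * be))).
    have : E < 1 by rewrite (le_lt_trans EB)// /B; lra.
    by rewrite /l; nra.
  apply: ler_pM.
  - by apply: mulr_ge0; apply: ltW.
  - by apply: mulr_ge0; apply: ltW.
  - by rewrite ler_pM2l.
  - by apply: ler_pM; lra.
- by rewrite tt0 lexx.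
Unshelve. all: by end_near. Qed.

Lemma perturbed_cvg i : w i @ +oo --> z i.
Proof.
apply/cvgrPdist_lt => e e0.
pose d := Num.min 2^-1 (e / z i).
have ez : 0 < e / z i by rewrite divr_gt0.
have d01 : 0 < d < 1.
  by rewrite lt_min gt_min ez; apply/andP; split; [|apply/orP; left]; lra.
have dz : d * z i <= e by rewrite -ler_pdivlMr// ge_min lexx orbT.
have [d0 _] := andP d01.
near=> t.
have h1 : w i t < (1 + d) * z i by near: t; exact: perturbed_near_lt.
have h2 : (1 - d) * z i < w i t by near: t; exact: perturbed_near_gt.
by rewrite ltr_norml; apply/andP; split; lra.
Unshelve. all: by end_near. Qed.

End Asymptotic.

(** * Consensus along linear cooperative systems *)

Section Consensus.
Context {R : realType} {N : nat}.
Variables (al : 'I_N -> 'I_N -> R -> R).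

Definition consensus_flow (q : 'I_N -> R -> R) := forall i (t : R), 0 < t ->
  is_derive t 1 (q i) (\sum_(k < N) al i k t * (q k t - q i t)).

Lemma consensus_flowN q : consensus_flow q ->
  consensus_flow (fun i t => - q i t).
Proof.
move=> dq i t t0; have h := is_deriveN (dq i t t0).
apply: (is_derive_eq h); rewrite -sumrN; apply: eq_bigr => k _; ring.
Qed.

(** Maximum principle. The slowly growing bound [c + e (1 + u - t0)] turns the weak inequality at a
    contact into a strict one. *)
Lemma consensus_flow_max q (c t0 t : R) i :
  (forall i k u, 0 < u -> 0 <= al i k u) -> consensus_flow q -> 0 < t0 <= t ->
  (forall k, q k t0 <= c) -> q i t <= c.
Proof.
move=> al0 dq /andP[t00]; rewrite le_eqVlt => /orP[/eqP <- //|t0t] qc.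
rewrite leNgt; apply/negP => cq.
(* At time [t] the slack [e * (1 + (t - t0))] is half of the excess of [q i t] over [c]. *)
pose e := (q i t - c) / (2 * (1 + (t - t0))).
have D0 : 0 < 2 * (1 + (t - t0)) by rewrite mulr_gt0// addr_gt0// subr_gt0.
have e0 : 0 < e by rewrite divr_gt0// subr_gt0.
pose f k u := c + e * (1 + (u - t0)) - q k u.
have df k (u : R) : t0 < u <= t -> is_derive u 1 (f k)
    (e - \sum_(j < N) al k j u * (q j u - q k u)).
  move=> /andP[t0u _].
  have dqk := dq k u (lt_trans t00 t0u).
  have dl : is_derive u 1 (fun u => c + e * (1 + (u - t0))) e.
    by apply: is_derive_eq; rewrite /GRing.scale/=; ring.
  exact: is_deriveB_fun dl dqk.
have : 0 < f i t.
  apply: (@barrier R 'I_N f t0 t); last by rewrite t0t lexx.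
  - move=> k; near=> u; rewrite subr_gt0; near: u.
    apply: (near_lt_cvg (a := q k t0) (b := c + e)).
    + by apply: cvg_at_right_filter; exact: is_derive_continuous (dq k t0 t00).
    + have dl : is_derive t0 1 (fun u => c + e * (1 + (u - t0))) e.
        by apply: is_derive_eq; rewrite /GRing.scale/=; ring.
      have := cvg_at_right_filter (is_derive_continuous dl).
      by rewrite subrr addr0 mulr1.
    + by rewrite ltr_pwDr.
  - by move=> k u /(df k)/is_derive_continuous.
  - move=> k u ut fu fk0; eexists; first exact: df.
    rewrite subr_gt0; apply: le_lt_trans e0; apply: sumr_le0 => j _.
    apply: mulr_ge0_le0.
      by apply: al0; case/andP: ut => + _; exact: lt_trans.
    by have := fu j; have := fk0; rewrite /f; lra.
rewrite /f /e invfM mulrA mulfVK; last by rewrite gt_eqF// addr_gt0// subr_gt0.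
by lra.
Unshelve. all: by end_near. Qed.

(** All differences [q i - q j] shrink exponentially. By the maximum principle the values after [t0]
    stay within [g t0] of [q i0 t0], so they are Cauchy with a common limit. *)
Lemma consensus q (a : R) : (0 < N)%N -> 0 < a ->
  (forall i k u, 0 < u -> a <= al i k u) -> consensus_flow q ->
  (forall i, q i u @[u --> 0^'+] --> q i 0) ->
  exists L : R, forall i, q i @ +oo --> L.
Proof.
move=> N0 a0 ala dq q0; pose i0 := Ordinal N0.
have al0 i k u : 0 < u -> 0 <= al i k u.
  by move=> /(ala i k); apply: le_trans; exact: ltW.
have [K K0 qK] := fin_ubound (fun ij : 'I_N * 'I_N => q ij.1 0 - q ij.2 0).
(* The differences contract at rate [a]; half of it leaves a strict inequality, as does the 1 in
   [K + 1] at time 0. *)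
pose l := a / 2.
have l0 : 0 < l by rewrite divr_gt0.
pose g t := 0 + (K + 1) * expR (- l * (t - 0)).
have gap t i j : 0 < t -> q i t - q j t < g t.
  move=> t0; rewrite -subr_gt0.
  pose f (ij : 'I_N * 'I_N) u := g u - (q ij.1 u - q ij.2 u).
  have df ij (u : R) : 0 < u -> is_derive u 1 (f ij)
     (- l * ((K + 1) * expR (- l * (u - 0))) -
      (\sum_(k < N) al ij.1 k u * (q k u - q ij.1 u) -
       \sum_(k < N) al ij.2 k u * (q k u - q ij.2 u))).
    move=> u0; apply: is_deriveB_fun; first exact: is_derive_expdecay.
    by apply: is_deriveB_fun; exact: dq.
  apply: (@barrier R ('I_N * 'I_N)%type f 0 t _ _ _ t (i, j)); last first.
  - by rewrite t0 lexx.
  - move=> [k h] u /andP[u0 _] fu /eqP; rewrite subr_eq0 => /eqP/= fkh.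
    eexists; first exact: df.
    (* A pair touching the barrier realises the diameter: [q k] is the maximum and [q h] the
       minimum. *)
    have qk j' : q j' u <= q k u.
      by have := fu (j', h); rewrite /f /= fkh; lra.
    have qh j' : q h u <= q j' u.
      by have := fu (k, j'); rewrite /f /= fkh; lra.
    have s1 : \sum_(j < N) al k j u * (q j u - q k u) <= a * (q h u - q k u).
      rewrite (bigD1 h)//= -[leRHS]addr0 lerD//.
        by rewrite ler_wnM2r ?ala// subr_le0.
      by apply: sumr_le0 => j' _; rewrite mulr_ge0_le0 ?al0// subr_le0.
    have s2 : 0 <= \sum_(j < N) al h j u * (q j u - q h u).
      by apply: sumr_ge0 => j' _; rewrite mulr_ge0 ?al0// subr_ge0.
    have : (K + 1) * expR (- l * (u - 0)) = q k u - q h u.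
      by rewrite -fkh /g add0r.
    have : 0 < (K + 1) * expR (- l * (u - 0)).
      by rewrite mulr_gt0 ?expR_gt0// addr_gt0.
    rewrite /= subr_gt0; move: (_ * expR _) => E E0 Eq.
    have : a * E = a * (q k u - q h u) by rewrite Eq.
    have : 0 < a * E by rewrite mulr_gt0.
    by rewrite /l; lra.
  - by move=> k u /andP[/(df k)/is_derive_continuous].
  - move=> [k h]; near=> u; rewrite subr_gt0; near: u.
    apply: (near_lt_cvg (cvgB (q0 k) (q0 h)) (b := K + 1)).
      have := is_derive_expdecay 0 (K + 1) l 0 (0 : R).
      move=> /is_derive_continuous/cvg_at_right_filter.
      by rewrite subrr mulr0 expR0 mulr1 add0r.
    by have /= := qK (k, h); lra.
have dist t t0 i : 0 < t0 <= t -> `|q i0 t0 - q i t| <= g t0.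
  move=> t0t; have [t00 _] := andP t0t.
  have h1 : - q i t <= - (q i0 t0) + g t0.
    apply: (consensus_flow_max i al0 (consensus_flowN dq) t0t) => k.
    by have := gap t0 i0 k t00; lra.
  have h2 : q i t <= q i0 t0 + g t0.
    apply: (consensus_flow_max i al0 dq t0t) => k.
    by have := gap t0 k i0 t00; lra.
  by rewrite ler_norml; apply/andP; split; lra.
have gsmall (e : R) : 0 < e -> \forall t \near +oo, g t < e.
  move=> e0; near=> t; rewrite /g add0r; near: t.
  exact: near_expdecay_lt.
have /cvg_ex[L qL] : cvg (q i0 @ +oo).
  apply/cauchy_cvgP; apply: cauchy_exP => e e0.
  near (pinfty_nbhs R) => t0.
  have t00 : 0 < t0 by near: t0; apply: nbhs_pinfty_gt; exact: num_real.
  exists (q i0 t0).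
  suff : \forall t \near +oo, ball (q i0 t0) e (q i0 t) by [].
  near=> t; rewrite /ball/=.
  apply: (@le_lt_trans _ _ (g t0)); last by near: t0; exact: gsmall.
  apply: dist; rewrite t00/=; near: t; apply: nbhs_pinfty_ge; exact: num_real.
exists L => i; apply/cvgrPdist_lt => e e0.
have e2 : 0 < e / 2 by rewrite divr_gt0.
have qLe : \forall t \near +oo, `|L - q i0 t| < e / 2.
  by move/cvgrPdist_lt : qL; apply.
near=> t.
have t00 : 0 < t by near: t; apply: nbhs_pinfty_gt; exact: num_real.
have h1 : `|L - q i0 t| < e / 2.
  by near: t.
have h2 : `|q i0 t - q i t| <= g t by apply: dist; rewrite t00 lexx.
have h3 : g t < e / 2 by near: t; exact: gsmall.
have := ler_normD (L - q i0 t) (q i0 t - q i t).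
by rewrite addrA subrK; lra.
Unshelve. all: by end_near. Qed.

End Consensus.

Lemma cvg_sum_ord {R : realType} {T : Type} (F : set_system T) {FF : Filter F}
    (n : nat) (f : 'I_n -> T -> R) (a : 'I_n -> R) :
  (forall k, f k @ F --> a k) ->
  (fun t => \sum_(k < n) f k t) @ F --> \sum_(k < n) a k.
Proof.
by move=> fa; apply: cvg_big => //; exact: add_continuous.
Qed.

(** * Linear cooperative systems with bounded diagonal coefficients *)

Section LinearFlow.
Context {R : realType} {N : nat}.
Variables (m : 'I_N -> R) (D : 'I_N -> R -> R) (K : R).
Hypotheses (m0 : forall i, 0 < m i) (K0 : 0 < K).
Hypothesis DK : forall i (t : R), 0 < t -> `|D i t| <= K.

(** The diagonal [D] is a function of time, so that a nonlinear damping evaluated along a solution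
    counts as a coefficient. The value at 0 enters as a right limit, the equation being required for
    [t > 0] only. *)
Definition linear_flow (x : 'I_N -> R -> R) :=
  (forall i, x i t @[t --> 0^'+] --> x i 0) /\
  forall i (t : R), 0 < t -> is_derive t 1 (x i)
    (\sum_(j < N) m j * (x j t - x i t) + D i t * x i t).

Lemma linear_flow_sum (n : nat) (e : 'I_n -> R) (x : 'I_n -> 'I_N -> R -> R) :
  (forall k, linear_flow (x k)) ->
  linear_flow (fun i t => \sum_(k < n) e k * x k i t).
Proof.
move=> xl; split=> [i|i t t0].
  apply: (cvg_sum_ord (f := fun k t => e k * x k i t)) => k.
  by apply: cvgM; [exact: cvg_cst|exact: (xl k).1].
have := is_derive_sum_fun (fun k => is_deriveZ_fun (e k) ((xl k).2 i t t0)).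
move=> h; apply: (is_derive_eq h).
under eq_bigr do rewrite mulrDr mulr_sumr.
rewrite big_split/= exchange_big/= mulr_sumr; congr (_ + _).
  apply: eq_bigr => j _; rewrite -sumrB mulr_sumr.
  by apply: eq_bigr => k _; ring.
by apply: eq_bigr => k _; ring.
Qed.

(** The barrier decays at rate [K + 1], faster than a damping bounded by [K] can force, and the
    coupling only pushes a smallest coordinate upwards. *)
Lemma linear_flow_pos x : linear_flow x -> (forall i, 0 < x i 0) ->
  forall i t, 0 < t -> 0 < x i t.
Proof.
move=> [xc dx] x0 i t t0.
have [c c0 cx] := fin_pos_lbound x0.
pose g u := 0 + (c / 2) * expR (- (K + 1) * (u - 0)).
have g0 u : 0 < g u by rewrite /g add0r mulr_gt0 ?expR_gt0// divr_gt0.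
have dg (u : R) : is_derive u 1 g (- (K + 1) * g u).
  apply: (is_derive_eq (is_derive_expdecay 0 (c / 2) (K + 1) 0 u)).
  by rewrite /g add0r.
pose f j u := x j u - g u.
have df j (u : R) (u0 : 0 < u) := is_deriveB_fun (dx j u u0) (dg u).
apply: lt_trans (g0 t) _; rewrite -subr_gt0.
apply: (@barrier R 'I_N f 0 t); last by rewrite t0 lexx.
- move=> j; near=> u; rewrite subr_gt0; near: u.
  apply: (near_lt_cvg (a := c / 2) (b := x j 0)); last 2 first.
  + exact: xc.
  + by have := cx j; lra.
  + have := is_derive_continuous (dg 0).
    move=> /cvg_at_right_filter.
    by rewrite /g subrr mulr0 expR0 mulr1 add0r.
- by move=> j u /andP[/(df j)/is_derive_continuous].
- move=> j u /andP[u0 ut] fu /eqP; rewrite subr_eq0 => /eqP xg.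
  eexists; first exact: df.
  have s0 : 0 <= \sum_(k < N) m k * (x k u - x j u).
    apply: sumr_ge0 => k _; apply: mulr_ge0; first exact: ltW.
    by have := fu k; rewrite /f -xg.
  have := DK j u0; rewrite ler_norml => /andP[h _].
  have := g0 u; rewrite xg in s0 *; move: (g u) s0 => G s0 G0.
  have : 0 <= (D j u + K) * G by apply: mulr_ge0; lra.
  by lra.
Unshelve. all: by end_near. Qed.

(** The weighted sum [s] feels no coupling, so it grows at rate at most [K], whereas a coordinate at
    the small fraction [c] of [s] is pulled up by the coupling. Hence [x i > c * s] persists, and
    [s >= m i * x i] bounds all ratios. *)
Lemma linear_flow_ratio x : (0 < N)%N -> linear_flow x ->
  (forall i, 0 < x i 0) ->
  exists2 a, 0 < a & forall i k t, 0 < t -> a <= m k * x k t / x i t.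
Proof.
move=> N0 xl x0; have [xc dx] := xl; have xp := linear_flow_pos xl x0.
pose s t := \sum_(k < N) m k * x k t.
have s_gt0 u : (forall k, 0 < x k u) -> 0 < s u.
  move=> xu; rewrite /s (bigD1 (Ordinal N0))//= ltr_wpDr//; last exact: mulr_gt0.
  by apply: sumr_ge0 => k _; apply: mulr_ge0; apply: ltW.
have [M ME] : exists M, M = \sum_(k < N) m k by eexists.
have M0 : 0 <= M by rewrite ME; apply: sumr_ge0 => k _; exact: ltW.
have MK0 : 0 < M + 2 * K by apply: ltr_wpDl => //; exact: mulr_gt0.
have cM0 : 0 < 2 * (M + 2 * K) by exact: mulr_gt0.
have [b b0 bx] := fin_pos_lbound (fun k => divr_gt0 (x0 k) (s_gt0 0 x0)).
(* At a contact [x j = c * s] the inequality wanted is [c (M + 2 K) < 1]: [M + K] comes from the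
   coupling and damping of [x j], another [K] from the growth of [s]. *)
pose c := Num.min (b / 2) (2 * (M + 2 * K))^-1.
have c0 : 0 < c by rewrite lt_min invr_gt0 cM0 divr_gt0.
have cb : c < b by rewrite gt_min; apply/orP; left; lra.
have cM : c * (M + 2 * K) < 1.
  apply: (@le_lt_trans _ _ (2^-1)); last by lra.
  rewrite -ler_pdivlMr; last by lra.
  by rewrite ge_min -invfM lexx orbT.
have sE j u : \sum_(k < N) m k * (x k u - x j u) = s u - M * x j u.
  by under eq_bigr do rewrite mulrBr; rewrite sumrB ME mulr_suml.
have ds u (u0 : 0 < u) := is_derive_sum_fun
  (fun k => is_deriveZ_fun (m k) (dx k u u0)).
pose f j u := x j u - c * s u.
have df j u (u0 : 0 < u) := is_deriveB_fun (dx j u u0)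
  (is_deriveZ_fun c (ds u u0)).
have xs i t : 0 < t -> c * s t < x i t.
  move=> t0; rewrite -subr_gt0.
  apply: (@barrier R 'I_N f 0 t); last by rewrite t0 lexx.
  - move=> j; near=> u; rewrite subr_gt0; near: u.
    apply: (near_lt_cvg (a := c * s 0) (b := x j 0)).
    + apply: cvgM; first exact: cvg_cst.
      apply: (cvg_sum_ord (f := fun k t => m k * x k t)) => k.
      by apply: cvgM; [exact: cvg_cst|exact: xc].
    + exact: xc.
    + by rewrite -ltr_pdivlMr ?s_gt0// (lt_le_trans cb).
  - by move=> j u /andP[/(df j)/is_derive_continuous].
  - move=> j u /andP[u0 ut] fu /eqP; rewrite subr_eq0 => /eqP xcs.
    eexists; first exact: df.
    have s0 := s_gt0 u (fun k => xp k u u0).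
    rewrite sE; under eq_bigr do rewrite sE mulrDr mulrBr.
    rewrite big_split/= sumrB -mulr_suml.
    (* Weighted by [m], the coupling cancels in the derivative of [s]. *)
    have -> : \sum_(k < N) m k * (M * x k u) = M * s u.
      by rewrite /s mulr_sumr; apply: eq_bigr => k _; ring.
    have h1 : \sum_(k < N) m k * (D k u * x k u) <= K * s u.
      rewrite /s mulr_sumr; apply: ler_sum => k _.
      rewrite [leRHS]mulrCA ler_pM2l// ler_pM2r ?xp//.
      by rewrite (le_trans (ler_norm _))// DK.
    have h2 : - K * x j u <= D j u * x j u.
      rewrite ler_pM2r ?xp//.
      by have := DK j u0; rewrite ler_norml => /andP[].
    have h3 := ler_wpM2l (ltW c0) h1.
    have h4 : 0 < s u * (1 - c * (M + 2 * K)).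
      by apply: mulr_gt0 => //; rewrite subr_gt0.
    rewrite -ME subrr add0r subr_gt0.
    apply: (le_lt_trans h3); apply: (@lt_le_trans _ _ (s u - M * x j u + - K * x j u)).
      rewrite xcs; lra.
    by rewrite lerD2l.
have [mu mu0 mum] := fin_pos_lbound m0.
exists (mu * mu * c); first by rewrite !mulr_gt0.
move=> i k t t0; rewrite ler_pdivlMr ?xp//.
have h1 : m i * x i t <= s t.
  rewrite /s (bigD1 i)//= lerDl; apply: sumr_ge0 => j _.
  by apply: mulr_ge0; apply: ltW => //; exact: xp.
have h2 : mu * x i t <= m i * x i t by rewrite ler_pM2r ?xp.
apply: (@le_trans _ _ (mu * (c * s t))).
  rewrite -!mulrA ler_pM2l// mulrCA ler_pM2l//.
  exact: le_trans h1.
apply: ler_pM => //.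
- exact: ltW.
- by apply: mulr_ge0; apply: ltW => //; apply: s_gt0 => j; exact: xp.
- exact/ltW/xs.
Unshelve. all: by end_near. Qed.

(* Quotients of two solutions of the same linear cooperative system obey a
   consensus equation, with weights [m k * x k / x i]. *)
Lemma linear_flow_consensus x y : (0 < N)%N -> linear_flow x -> linear_flow y ->
  (forall i, 0 < x i 0) ->
  exists L : R, forall i, (fun t => y i t / x i t) @ +oo --> L.
Proof.
move=> N0 xl yl x0; have xp := linear_flow_pos xl x0.
have [a a0 ha] := linear_flow_ratio N0 xl x0.
apply: (@consensus R N (fun i k t => m k * x k t / x i t)
  (fun i t => y i t / x i t) a) => //.
- move=> i t t0; have xi0 : x i t != 0 by rewrite gt_eqF ?xp.
  have := is_deriveM_fun (yl.2 i t t0) (is_deriveV_fun xi0 (xl.2 i t t0)).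
  move=> h; apply: (is_derive_eq h).
  (* The common diagonal coefficient [D i t] drops out of the quotient. *)
  transitivity (\sum_(k < N) (y i t * (- x i t ^- 2 * (m k * (x k t - x i t)))
     + (x i t)^-1 * (m k * (y k t - y i t)))).
    rewrite big_split/= -!mulr_sumr !mulrDr addrACA -[RHS]addr0.
    by congr (_ + _); field.
  apply: eq_bigr => k _; field.
  by rewrite xi0 gt_eqF ?xp.
- move=> i; apply: cvgM; first exact: yl.1.
  by apply: cvgV; [rewrite gt_eqF|exact: xl.1].
Qed.

End LinearFlow.

(** * Solutions of (OV) and (OY) *)

Section RowVectors.
Context {R : realType}.

Lemma cvg_row {T : Type} (F : set_system T) {FF : Filter F} (n : nat)
    (f : T -> 'rV[R]_n) (L : 'rV[R]_n) :
  (forall k, (fun t => f t 0 k) @ F --> L 0 k) -> f @ F --> L.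
Proof.
move=> fL; apply/cvgrPdist_le => /= e e0.
near=> x.
rewrite /Num.Def.normr/= mx_normrE (bigmax_le _ (ltW e0))//= => -[i k] _.
rewrite !mxE/= ord1.
move: k; near: x; apply: filter_forall => /= k.
by move/cvgrPdist_le : (fL k); apply.
Unshelve. all: by end_near. Qed.

Lemma row_norm_le (n : nat) (x : 'rV[R]_n) (c : R) : 0 <= c ->
  (forall k, `|x 0 k| <= c) -> `|x| <= c.
Proof.
move=> c0 xc; rewrite /Num.Def.normr/= mx_normrE (bigmax_le _ c0)//= => -[i k] _.
by rewrite /= ord1.
Qed.

Lemma coord_le_row_norm (n : nat) (x : 'rV[R]_n) k : `|x 0 k| <= `|x|.
Proof.
rewrite [leRHS]/Num.Def.normr/= mx_normrE.
by apply: le_trans; last exact: (le_bigmax _ _ (0, k)).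
Qed.

Lemma is_derive_coord (n : nat) (f : R -> 'rV[R]_n) (t : R) k :
  derivable f t 1 -> is_derive t 1 (fun s => f s 0 k) ('D_1 f t 0 k).
Proof.
move=> fd; split; first exact: (derivable_mxP f t 1).1.
by rewrite derive_mx// mxE.
Qed.

Lemma within_ge0_cvg (V : normedModType R) (A : set R) (f : R -> V) (e : R) :
  0 < e -> (forall t, 0 <= t < e -> A t) ->
  {within A, continuous f} -> f t @[t --> 0^'+] --> f 0.
Proof.
move=> e0 eA fc.
have A0 : A 0 by apply: eA; rewrite lexx e0.
have /subspace_continuousP/(_ 0 A0) := fc.
apply: cvg_trans; apply: cvg_fmap2 => W WA.
have WA' : \forall t \near (0 : R), A t -> W t by [].
suff : \forall t \near (0 : R), 0 < t -> W t by [].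
near=> t => t0.
have : A t -> W t by near: t.
apply; apply: eA; rewrite ltW//=; near: t.
exact: lt_nbhsl.
Unshelve. all: by end_near. Qed.

Lemma cvg_coord {T : Type} (F : set_system T) {FF : Filter F} (n : nat)
    (f : T -> 'rV[R]_n) (L : 'rV[R]_n) k :
  f @ F --> L -> (fun t => f t 0 k) @ F --> L 0 k.
Proof.
move=> fL; apply: (@cvg_comp _ _ _ f (fun M : 'rV[R]_n => M 0 k) _ _ _ fL).
exact: coord_continuous.
Qed.

Lemma enorm_ge0 (n : nat) (x : 'rV[R]_n) : 0 <= enorm x.
Proof. exact: sqrtr_ge0. Qed.

Lemma enormZ (n : nat) (a : R) (x : 'rV[R]_n) : 0 <= a ->
  enorm (a *: x) = a * enorm x.
Proof.
move=> a0; rewrite /enorm.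
under eq_bigr do rewrite mxE exprMn.
by rewrite -mulr_sumr sqrtrM ?sqr_ge0// sqrtr_sqr ger0_norm.
Qed.

Lemma cvg_enorm {T : Type} (F : set_system T) {FF : Filter F} (n : nat)
    (f : T -> 'rV[R]_n) (L : 'rV[R]_n) :
  (forall k, (fun t => f t 0 k) @ F --> L 0 k) ->
  (fun t => enorm (f t)) @ F --> enorm L.
Proof.
move=> fL; rewrite /enorm.
apply: (@cvg_comp _ _ _ (fun t => \sum_(k < n) f t 0 k ^+ 2) Num.sqrt).
  apply: (cvg_sum_ord (f := fun k t => f t 0 k ^+ 2)) => k.
  exact: cvgM (fL k) (fL k).
exact: sqrt_continuous.
Qed.

End RowVectors.

(** * Sectorial solutions of (OV) *)

Section OV.
Context {R : realType} {N n : nat}.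
Variables (th m : 'rV[R]_N) (s p : R).
Hypotheses (th0 : posvec th) (m0 : posvec m) (s0 : 0 < s) (p0 : 0 < p).
Variable v : R -> 'I_N -> 'rV[R]_n.
Hypothesis hv : solOV th m s p v.

Let D (i : 'I_N) (t : R) := s * (th 0 i - enorm (v t i) `^ p).

(** Along a fixed solution the damping factor is the same scalar for all coordinates of [v i], so
    all coordinates solve one linear system. *)
Lemma solOV_coord k : linear_flow (m 0) D (fun i t => v t i 0 k).
Proof.
split=> [i|i t t0].
  apply: (@cvg_coord _ _ _ _ n (fun t => v t i) (v 0 i)).
  apply: (within_ge0_cvg (e := 1) _ _ (hv i).1) => // t.
  by move=> /andP[].
have [dv E] := (hv i).2 t t0.
apply: (is_derive_eq (is_derive_coord k dv)).
rewrite E !mxE summxE /D; congr (_ + _).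
by apply: eq_bigr => j _; rewrite !mxE.
Qed.

(** When the largest speed reaches a value [B] with [B^p > th i] for all [i], the coupling cannot
    increase it and the damping lowers it. Squared norms are compared, being polynomial in the
    coordinates. *)
Lemma solOV_bounded : exists2 B, 0 < B & forall i t, 0 < t -> enorm (v t i) <= B.
Proof.
have [C1 C10 vC1] := fin_ubound (fun i => enorm (v 0 i)).
have [C2 C20 thC2] := fin_ubound (th 0).
have C2p : 0 < C2 `^ p^-1 by exact: powR_gt0.
(* [C1] covers the initial speeds and the power of [C2] the thresholds set by the [th i]; both are
   exceeded strictly. *)
pose B := C1 + 1 + C2 `^ p^-1.
have B0 : 0 < B by rewrite addr_gt0// addr_gt0.
have C1B : C1 < B by rewrite /B -addrA ltrDl addr_gt0.
have thB i : th 0 i < B `^ p.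
  rewrite (le_lt_trans (thC2 i))//.
  have -> : C2 = (C2 `^ p^-1) `^ p.
    by rewrite -powRrM mulVf ?gt_eqF// powRr1// ltW.
  apply: gt0_ltr_powR => //; rewrite ?nnegrE ?powR_ge0 ?(ltW B0)//.
  by rewrite /B ltrDr addr_gt0.
exists B => // i t t0.
pose g j u := \sum_(k < n) v u j 0 k * v u j 0 k.
have gE j u : enorm (v u j) = Num.sqrt (g j u).
  by rewrite /enorm; congr Num.sqrt; apply: eq_bigr => k _; rewrite expr2.
have dg j (u : R) (u0 : 0 < u) := is_derive_sum_fun (fun k =>
  is_deriveM_fun ((solOV_coord k).2 j u u0) ((solOV_coord k).2 j u u0)).
pose f j u := B * B - g j u.
have df j (u : R) (u0 : 0 < u) :=
  is_deriveB_fun (is_derive_cst (B * B) u 1) (dg j u u0).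
have fE j u : (0 < f j u) = (enorm (v u j) < B).
  rewrite /f subr_gt0 gE -expr2 -[X in _ = (_ < X)](ger0_norm (ltW B0)).
  by rewrite -sqrtr_sqr ltr_sqrt// exprn_gt0.
apply: ltW; rewrite -fE.
apply: (@barrier R 'I_N f 0 t); last by rewrite t0 lexx.
- move=> j; near=> u; rewrite subr_gt0; near: u.
  apply: (near_lt_cvg (a := g j 0) (b := B * B)); last 2 first.
  + exact: cvg_cst.
  + by rewrite -subr_gt0 -/(f j 0) fE (le_lt_trans (vC1 j)).
  apply: (cvg_sum_ord (f := fun k t => v t j 0 k * v t j 0 k)) => k.
  by have vc := (solOV_coord k).1 j; exact: (cvgM vc vc).
- by move=> j u /andP[/(df j)/is_derive_continuous].
- move=> j u /andP[u0 ut] fu /eqP; rewrite subr_eq0 => /eqP gB.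
  eexists; first exact: df.
  have vB : enorm (v u j) = B by rewrite gE -gB -expr2 sqrtr_sqr gtr0_norm.
  rewrite sub0r oppr_gt0.
  (* In each coordinate [2 a (b - a) <= b^2 - a^2], so the coupling is bounded by differences of
     squared speeds. *)
  apply: (@le_lt_trans _ _ (\sum_(k < n) (\sum_(h < N) m 0 h *
      (v u h 0 k * v u h 0 k - v u j 0 k * v u j 0 k) +
      2 * D j u * (v u j 0 k * v u j 0 k)))).
    apply: ler_sum => k _.
    rewrite -mulrDr [leLHS](_ : _ = \sum_(h < N) m 0 h *
      (2 * v u j 0 k * (v u h 0 k - v u j 0 k)) +
      2 * D j u * (v u j 0 k * v u j 0 k)); last first.
      rewrite (_ : \sum_(h < N) m 0 h * (2 * v u j 0 k * (v u h 0 k - v u j 0 k)) =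
        2 * v u j 0 k * \sum_(h < N) m 0 h * (v u h 0 k - v u j 0 k)).
        by ring.
      by rewrite mulr_sumr; apply: eq_bigr => h _; ring.
    rewrite lerD2r; apply: ler_sum => h _; rewrite ler_pM2l; last exact: m0.
    have := sqr_ge0 (v u h 0 k - v u j 0 k); rewrite expr2.
    by lra.
  rewrite big_split/= exchange_big/= -mulr_sumr -/(g j u) -gB.
  rewrite ltr_wnDl//.
    apply: sumr_le0 => h _; rewrite -mulr_sumr sumrB.
    apply: mulr_ge0_le0; first exact: ltW (m0 h).
    by have := fu h; rewrite /f gB -/(g h u) -/(g j u); lra.
  rewrite nmulr_rlt0 ?mulr_gt0// pmulr_rlt0// /D pmulr_rlt0// vB subr_lt0.
  exact: thB.
Unshelve. all: by end_near. Qed.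

Lemma solOV_damping_bounded : exists2 K, 0 < K &
  forall i (t : R), 0 < t -> `|D i t| <= K.
Proof.
have [B B0 vB] := solOV_bounded.
have [C C0 thC] := fin_ubound (th 0).
exists (s * (C + B `^ p)); first by rewrite mulr_gt0// addr_gt0// powR_gt0.
move=> i t t0; rewrite /D normrM gtr0_norm// ler_pM2l//.
rewrite (le_trans (ler_normB _ _))//.
rewrite (gtr0_norm (th0 i)) (ger0_norm (powR_ge0 _ _)) lerD//.
by apply: (ge0_ler_powR (ltW p0)); rewrite ?nnegrE ?enorm_ge0 ?(ltW B0) ?vB.
Qed.

Lemma solOV_cvg z : (0 < N)%N -> sectorial v ->
  (forall i, 0 < z i) -> (forall i, field_OY (th 0) (m 0) s p 1 z i = 0) ->
  exists u : 'rV[R]_n, enorm u = 1 /\ forall i, v t i @[t --> +oo] --> z i *: u.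
Proof.
move=> N0 [e [e1 ve]] z0 Fz.
have [K K0 DK] := solOV_damping_bounded.
pose x i t := \sum_(k < n) e 0 k * v t i 0 k.
have xl : linear_flow (m 0) D x.
  exact: (linear_flow_sum (e 0) solOV_coord).
have xp := linear_flow_pos m0 DK xl ve.
have [V qV] : exists V : 'rV[R]_n,
    forall k i, (fun t => v t i 0 k / x i t) @ +oo --> V 0 k.
  have H k : exists L : R, forall i, (fun t => v t i 0 k / x i t) @ +oo --> L.
    exact: (linear_flow_consensus m0 K0 DK N0 xl (solOV_coord k) ve).
  have [L HL] := choice H.
  by exists (\row_(k < n) L k) => k i; rewrite mxE; exact: HL.
pose Q i t := (x i t)^-1 *: v t i.
have QV i k : (fun t => Q i t 0 k) @ +oo --> V 0 k.
  have := qV k i; rewrite (_ : (fun t => Q i t 0 k) = (fun t => v t i 0 k / x i t))//.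
  by apply/funext => t; rewrite mxE mulrC.
(* [e . Q i] is identically 1 for positive times, so the limit satisfies [e . V = 1] and [V] is
   nonzero. *)
have eV : \sum_(k < n) e 0 k * V 0 k = 1.
  have h1 : (fun t => \sum_(k < n) e 0 k * Q (Ordinal N0) t 0 k) @ +oo -->
      \sum_(k < n) e 0 k * V 0 k.
    apply: (cvg_sum_ord (f := fun k t => e 0 k * Q (Ordinal N0) t 0 k)) => k.
    by apply: cvgM; [exact: cvg_cst|exact: QV].
  have h2 : (fun t => \sum_(k < n) e 0 k * Q (Ordinal N0) t 0 k) @ +oo -->
      (1 : R).
    apply: cvg_near_cst; near=> t.
    have t0 : 0 < t by near: t; apply: nbhs_pinfty_gt; exact: num_real.
    rewrite -[RHS](mulVf (lt0r_neq0 (xp (Ordinal N0) t t0))) /x mulr_sumr.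
    by apply: eq_bigr => k _; rewrite mxE mulrCA.
  by rewrite -(cvg_lim _ h1)// (cvg_lim _ h2).
pose r := enorm V.
have r0 : 0 < r.
  rewrite sqrtr_gt0 lt_neqAle; apply/andP; split; last first.
    by apply: sumr_ge0 => k _; exact: sqr_ge0.
  apply/eqP => /esym/eqP; rewrite psumr_eq0; last by move=> k _; exact: sqr_ge0.
  move=> /allP V0; move: eV; rewrite big1 => [/eqP|k _].
    by rewrite eq_sym oner_eq0.
  have := V0 k (mem_index_enum _); rewrite sqrf_eq0 => /eqP ->.
  by rewrite mulr0.
(* Since [|v i| = w i * |Q i| / r], the term [|v i|^p] reads [c i * (w i)^p], and [c i] tends to
   1. *)
pose w i t := r * x i t.
pose c i t := (enorm (Q i t) / r) `^ p.
have vE i t : 0 < t -> v t i = x i t *: Q i t.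
  by move=> t0; rewrite scalerA divff ?scale1r// gt_eqF ?xp.
have wz i : w i t @[t --> +oo] --> z i.
  apply: (@perturbed_cvg _ _ (th 0) (m 0) s p m0 s0 p0 z z0 Fz w c).
  - by move=> j t t0; rewrite mulr_gt0 ?xp.
  - move=> j t t0.
    apply: (is_derive_eq (is_deriveZ_fun r (xl.2 j t t0))).
    rewrite /field_OY mulrDr mulr_sumr; congr (_ + _).
      by apply: eq_bigr => k _; rewrite /w; ring.
    rewrite /D vE// enormZ ?ltW ?xp// /c -powRM; last 2 first.
    + by rewrite divr_ge0 ?enorm_ge0// ltW.
    + by apply: mulr_ge0; apply: ltW => //; exact: xp.
    rewrite /w (_ : _ / r * _ = x j t * enorm (Q j t)); last first.
      by field; rewrite gt_eqF.
    by ring.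
  - move=> j; rewrite /c.
    have rr : enorm (Q j t) / r @[t --> +oo] --> (1 : R).
      rewrite -(divff (lt0r_neq0 r0)); apply: cvgM; last exact: cvg_cst.
      exact: cvg_enorm.
    rewrite -[X in _ --> X](_ : 1 `^ p = 1); last by rewrite powR1.
    apply: (@cvg_comp _ _ _ (fun t => enorm (Q j t) / r) (@powR R ^~ p) _ _ _ rr).
    exact: is_derive_continuous (is_derive1_powR p ltr01).
exists (r^-1 *: V); split.
  by rewrite enormZ ?invr_ge0 ?ltW// mulVf// gt_eqF.
move=> i; apply: cvg_row => k.
have h : (fun t => r^-1 * (w i t * Q i t 0 k)) @ +oo --> r^-1 * (z i * V 0 k).
  exact: (cvgM (cvg_cst r^-1) (cvgM (wz i) (QV i k))).
rewrite !mxE.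
rewrite (_ : z i * (r^-1 * V 0 k) = r^-1 * (z i * V 0 k)); last by ring.
apply: (@cvg_trans _ ((fun t => r^-1 * (w i t * Q i t 0 k)) @ +oo) _ _ _ h).
apply: near_eq_cvg; near=> t.
have t0 : 0 < t by near: t; apply: nbhs_pinfty_gt; exact: num_real.
by rewrite /= /w -mulrA mulKf ?(gt_eqF r0)// [in RHS]vE// [RHS]mxE.
Unshelve. all: by end_near. Qed.

End OV.

(** * Stability and convergence for (OY) *)

Section OY.
Context {R : realType} {N : nat}.
Variables (th m : 'rV[R]_N) (s p : R).
Hypotheses (th0 : posvec th) (m0 : posvec m) (s0 : 0 < s) (p0 : 0 < p).

Lemma equilibriumE y : equilibrium th m s p y <->
  forall i, field_OY (th 0) (m 0) s p 1 (y 0) i = 0.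
Proof.
by split=> H i; have := H i; rewrite /field_OY mul1r.
Qed.

Lemma solOY_coord T y : solOY th m s p T y -> forall i (t : R),
  0 < t -> (t%:E < T)%E -> is_derive t 1 (fun t => y t 0 i)
    (field_OY (th 0) (m 0) s p 1 (fun k => y t 0 k) i).
Proof.
move=> [_ dy] i t t0 tT; have [yd E] := dy t t0 tT.
apply: (is_derive_eq (is_derive_coord i yd)).
by rewrite E mxE /field_OY mul1r.
Qed.

Lemma solOY_right_cvg T y (t : R) : solOY th m s p T y -> 0 < t ->
  (t%:E < T)%E -> forall i, (fun u => y u 0 i) @ 0^'+ --> y 0 0 i.
Proof.
move=> [yc _] t0 tT i; apply: cvg_coord.
apply: (within_ge0_cvg t0 _ yc) => u /andP[u0 ut]; split => //.
by apply: lt_trans tT; rewrite lte_fin.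
Qed.

Variable z : 'rV[R]_N.
Hypotheses (z0 : posvec z) (Fz : equilibrium th m s p z).

(** The attraction estimate is relative to [z]; passing to the norm and back costs the ratio of an
    upper bound [C] to a lower bound [c] of the coordinates of [z]. *)
Lemma equilibrium_loc_exp_stable : loc_exp_stable th m s p z.
Proof.
have Fz' := (equilibriumE z).1 Fz.
have [l l0 hl] := equilibrium_exp_attracts m0 s0 p0 z0 Fz'.
have [c c0 cz] := fin_pos_lbound z0.
have [C C0 zC] := fin_ubound (z 0).
(* [delta = c / 4] makes [A = 2 d / c] at most 1/2; the summand 1 settles time 0. *)
exists (c / 4), (1 + 2 * C / c), l.
have Cc : 0 < 2 * C / c by rewrite divr_gt0// mulr_gt0.
do 3 (split; first by [rewrite divr_gt0|rewrite addr_gt0|]).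
move=> T y ysol yz t [t0 tT].
set d := `|y 0 - z| in yz *.
have d0 : 0 <= d by exact: normr_ge0.
move: t0; rewrite le_eqVlt => /orP[/eqP <-|t0].
  rewrite mulr0 expR0 mulr1 -[leLHS]mul1r ler_wpM2r// lerDl.
  exact: ltW.
have bound A : 0 < A <= 2^-1 -> d < A * c ->
    `|y t - z| <= A * expR (- l * t) * C.
  move=> A01 dA; have [A0 _] := andP A01.
  apply: row_norm_le.
    by apply: mulr_ge0; [apply: mulr_ge0; [exact: ltW|exact: expR_ge0]|exact: ltW].
  move=> k; rewrite !mxE; apply: ltW.
  apply: (@lt_le_trans _ _ (A * expR (- l * t) * z 0 k)); last first.
    by rewrite ler_wpM2l// mulr_ge0 ?expR_ge0// ltW.
  apply: (hl (fun i t => y t 0 i) t A) => //.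
  - move=> i u /andP[u0 ut]; apply: (solOY_coord ysol) => //.
    by apply: le_lt_trans tT; rewrite lee_fin.
  - exact: solOY_right_cvg ysol t0 tT.
  - move=> i; apply: (@le_lt_trans _ _ d).
      by have := coord_le_row_norm (y 0 - z) i; rewrite !mxE.
    by rewrite (lt_le_trans dA)// ler_pM2l.
  - by rewrite t0 lexx.
have e0 : 0 < expR (- l * t) := expR_gt0 _.
have e1 : expR (- l * t) <= 1 by rewrite -expR0 ler_expR; nra.
move: d0; rewrite le_eqVlt => /orP[/eqP dE|d0].
  rewrite -dE mulr0 leNgt; apply/negP => q0.
  (* The estimate asks for [A > 0]. If [d = 0], a small [A] gives [|y t - z| <= |y t - z| / 2],
     against the assumption that this norm is positive. *)
  pose A := Num.min 2^-1 (`|y t - z| / (2 * C)).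
  have A0 : 0 < A by rewrite lt_min invr_gt0 ltr0n divr_gt0// mulr_gt0.
  have AC : A * C <= `|y t - z| / 2.
    by rewrite -ler_pdivlMr// -mulrA -invfM ge_min lexx orbT.
  have : `|y t - z| <= A * expR (- l * t) * C.
    apply: bound; first by rewrite A0 ge_min lexx.
    by rewrite -dE mulr_gt0.
  have : A * expR (- l * t) * C <= A * C.
    by rewrite mulrAC ler_piMr// mulr_ge0// ltW.
  by lra.
have Ac : 0 < 2 * d / c by rewrite divr_gt0// mulr_gt0.
have := bound (2 * d / c).
rewrite Ac mulfVK ?gt_eqF// => h.
apply: (@le_trans _ _ (2 * d / c * expR (- l * t) * C)).
  apply: h; last by lra.
  by rewrite ler_pdivrMr//; lra.
rewrite [leLHS](_ : _ = 2 * C / c * (expR (- l * t) * d)); last by ring.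
rewrite -[leRHS]mulrA ler_wpM2r ?lerDr//.
by rewrite mulr_ge0 ?expR_ge0// ltW.
Qed.

(** The convergence result for perturbed fields applies with all factors equal to 1, once positivity
    at all [t > 0] is known; a constant barrier [c z] with [c < 1] provides it. *)
Lemma solOY_cvg y : solOY th m s p +oo%E y -> posvec (y 0) ->
  y t @[t --> +oo] --> z.
Proof.
move=> ysol y0; have Fz' := (equilibriumE z).1 Fz.
apply: cvg_row => i.
have dy k (t : R) (t0 : 0 < t) := solOY_coord ysol k t0 (ltry t).
have [b b0 yb] := fin_pos_lbound (fun i => divr_gt0 (y0 i) (z0 i)).
pose c := Num.min (b / 2) 2^-1.
have c0 : 0 < c by rewrite lt_min divr_gt0//=; lra.
have cb : c < b by rewrite gt_min; apply/orP; left; lra.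
have c1 : c < 1 by rewrite gt_min; apply/orP; right; lra.
apply: (@perturbed_cvg _ _ (th 0) (m 0) s p m0 s0 p0 (z 0) z0 Fz'
  (fun i t => y t 0 i) (fun _ _ => 1)) => //; last first.
  by move=> _; exact: cvg_cst.
move=> j t t0; apply: lt_trans (_ : c * z 0 j < _); first by rewrite mulr_gt0.
apply: (@lower_barrier _ _ (th 0) (m 0) s p m0 (z 0) z0 Fz'
  (fun i t => y t 0 i) (fun _ _ => 1) (fun=> c) (fun=> 0) 0 t) => //.
- by move=> k u /andP[u0 _]; exact: dy.
- move=> k; apply: (near_lt_cvg (a := c * z 0 k) (b := y 0 0 k)).
  + exact: cvg_cst.
  + exact: (solOY_right_cvg (t := 1) ysol ltr01 (ltry _)).

  + by rewrite -ltr_pdivlMr// (lt_le_trans cb).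
- move=> k u _; rewrite mul1r !mulr_gt0 ?powR_gt0// subr_gt0.
  have : 1 < c^-1 `^ p by apply: powR_gt1 => //; rewrite invf_gt1.
  rewrite -powR_inv1 ?ltW// powRAC powR_inv1 ?powR_ge0// invf_gt1//.
  exact: powR_gt0.
- by rewrite t0 lexx.
Qed.

End OY.

(** * Smooth dependence on the parameters *)

Lemma is_derive_quotient {R : realType} {V : normedModType R} (f : V -> R)
    (x v : V) (d : R) :
  (fun h : R => h^-1 * (f (h *: v + x) - f x)) @ 0^' --> d -> is_derive x v f d.
Proof. by move=> fd; split; [exact: cvgP fd|exact: cvg_lim fd]. Qed.

(** Caratheodory's form of differentiability: the factorisation is exact and holds at [t = x] too,
    so an increment that vanishes needs no separate case. *)
Lemma caratheodory_slope {R : realType} (f : R -> R) (x d : R) :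
  is_derive x 1 f d ->
  exists2 S : R -> R, (forall t, f t - f x = S t * (t - x)) & S @ x --> d.
Proof.
move=> [fd fE].
have fl : (fun h => h^-1 *: ((f \o shift x) (h *: 1) - f x)) @ 0^' --> d.
  by rewrite -fE; exact: fd.
exists (fun t => if t == x then d else (f t - f x) / (t - x)).
  move=> t; case: eqP => [->|/eqP tx]; first by rewrite !subrr mulr0.
  by rewrite divfK// subr_eq0.
apply/cvgrPdist_lt => e e0.
move/cvgrPdist_lt : fl => /(_ e e0).
rewrite /= near_withinE => /nbhs_ballP[r /= r0 Hr].
apply/nbhs_ballP; exists r => //= t xt.
case: eqP => [_|/eqP tx]; first by rewrite subrr normr0.
have := Hr (t - x); rewrite /ball/= sub0r normrN distrC => /(_ xt).
rewrite subr_eq0 => /(_ tx); rewrite /shift /= [_ *: 1]mulr1 subrK.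
by rewrite /GRing.scale/= mulrC.
Qed.

(** * Continuity of the equilibrium in the parameters *)

Section Param.
Context {R : realType} {N : nat}.
Local Notation V := ('rV[R]_N * 'rV[R]_N * R)%type.

Lemma theta_coord_cvg (z : V) i : (fun x : V => x.1.1 0 i) @ z --> z.1.1 0 i.
Proof.
apply: (cvg_coord (f := fun x : V => x.1.1) (L := z.1.1)).
by apply: cvg_comp; [exact: cvg_fst|exact: cvg_fst].
Qed.

Lemma mass_coord_cvg (z : V) i : (fun x : V => x.1.2 0 i) @ z --> z.1.2 0 i.
Proof.
apply: (cvg_coord (f := fun x : V => x.1.2) (L := z.1.2)).
by apply: cvg_comp; [exact: cvg_fst|exact: cvg_snd].
Qed.

Lemma paramdom_near (z : V) : paramdom z -> \forall x \near z, paramdom x.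
Proof.
move=> [th0 [m0 s0]].
have h1 : \forall x \near z, forall i, 0 < (x : V).1.1 0 i.
  by apply: (@filter_forall _ _ _ _ (nbhs_filter z)) => i;
     exact: (cvgr_gt _ (@theta_coord_cvg z i) _ (th0 i)).
have h2 : \forall x \near z, forall i, 0 < (x : V).1.2 0 i.
  by apply: (@filter_forall _ _ _ _ (nbhs_filter z)) => i;
     exact: (cvgr_gt _ (@mass_coord_cvg z i) _ (m0 i)).
have h3 : \forall x \near z, 0 < (x : V).2.
  exact: (cvgr_gt _ (@cvg_snd _ _ _ _ _) _ s0).
near=> x; split; [|split]; near: x => //.
Unshelve. all: by end_near. Qed.

Lemma field_param_cvg (p : R) (y : 'I_N -> R) i (z : V) :
  (fun x : V => field_OY (x.1.1 0) (x.1.2 0) x.2 p 1 y i) @ z -->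
  field_OY (z.1.1 0) (z.1.2 0) z.2 p 1 y i.
Proof.
rewrite /field_OY; apply: cvgD.
  apply: (cvg_sum_ord (f := fun k (x : V) => x.1.2 0 k * (y k - y i))) => k.
  by apply: cvgM; [exact: mass_coord_cvg|exact: cvg_cst].
apply: cvgM; last exact: cvg_cst.
apply: cvgM; first exact: cvg_snd.
apply: cvgB; [exact: theta_coord_cvg|exact: cvg_cst].
Qed.

Variables (p : R) (Y : V -> 'rV[R]_N).
Hypothesis p0 : 0 < p.
Hypothesis hY : forall z, paramdom z ->
  posvec (Y z) /\ equilibrium z.1.1 z.1.2 z.2 p (Y z).

(** [(1 + d) y] and [(1 - d) y] are a strict super- and subsolution at [z]. For these fixed vectors
    the signs persist at nearby parameters, and comparison traps [Y x] between them. *)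
Lemma equilibrium_map_cvg z i : paramdom z -> (fun x => Y x 0 i) @ z --> Y z 0 i.
Proof.
move=> Uz; have [th0 [m0 s0]] := Uz; have [y0 /equilibriumE Fy] := hY Uz.
set y := Y z 0 in y0 Fy *.
apply/cvgrPdist_le => e e0.
pose d := Num.min 2^-1 (e / y i).
have ey : 0 < e / y i by rewrite divr_gt0// y0.
have d0 : 0 < d by rewrite lt_min ey; apply/andP; split; lra.
have d1 : d < 1 by rewrite gt_min; apply/orP; left; lra.
have dy : d * y i <= e by rewrite -ler_pdivlMr ?y0// ge_min lexx orbT.
have up k : field_OY (z.1.1 0) (z.1.2 0) z.2 p 1 (fun k => (1 + d) * y k) k < 0.
  rewrite field_OY_scale ?addr_gt0 ?y0// Fy add0r pmulr_rlt0 ?addr_gt0//.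
  rewrite nmulr_rlt0 ?y0// nmulr_rlt0 ?powR_gt0 ?y0// pmulr_rlt0//.
  by rewrite mul1r subr_lt0 powR_gt1// ltrDl.
have lo k : 0 < field_OY (z.1.1 0) (z.1.2 0) z.2 p 1 (fun k => (1 - d) * y k) k.
  have d10 : 0 < 1 - d by rewrite subr_gt0.
  rewrite field_OY_scale ?y0// Fy add0r !mulr_gt0 ?y0 ?powR_gt0//.
  have : 1 < (1 - d)^-1 `^ p by apply: powR_gt1 => //; rewrite invf_gt1//; lra.
  rewrite -powR_inv1 ?ltW// powRAC powR_inv1 ?powR_ge0// invf_gt1 ?powR_gt0//.
  by rewrite mul1r subr_gt0.
have upn : \forall x \near z, forall k,
    field_OY ((x : V).1.1 0) (x.1.2 0) x.2 p 1 (fun k => (1 + d) * y k) k < 0.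
  apply: (@filter_forall _ _ _ _ (nbhs_filter z)) => k.
  exact: (cvgr_lt _ (@field_param_cvg p _ k z) _ (up k)).
have lon : \forall x \near z, forall k,
    0 < field_OY ((x : V).1.1 0) (x.1.2 0) x.2 p 1 (fun k => (1 - d) * y k) k.
  apply: (@filter_forall _ _ _ _ (nbhs_filter z)) => k.
  exact: (cvgr_gt _ (@field_param_cvg p _ k z) _ (lo k)).
near=> x.
have Ux : paramdom x by near: x; exact: paramdom_near.
have [xth0 [xm0 xs0]] := Ux; have [Yx0 /equilibriumE FYx] := hY Ux.
have h1 : Y x 0 i <= (1 + d) * y i.
  apply: (@subsol_le_supersol _ _ (x.1.1 0) (x.1.2 0) x.2 p xm0 xs0 p0 (Y x 0)
    (fun k => (1 + d) * y k)) => //.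
  - by move=> k; rewrite mulr_gt0 ?addr_gt0 ?y0.
  - by move=> k; rewrite FYx.
  - by move=> k; apply: ltW; move: k; near: x.
have h2 : (1 - d) * y i <= Y x 0 i.
  apply: (@subsol_le_supersol _ _ (x.1.1 0) (x.1.2 0) x.2 p xm0 xs0 p0
    (fun k => (1 - d) * y k) (Y x 0)) => //.
  - by move=> k; rewrite mulr_gt0 ?subr_gt0 ?y0.
  - by move=> k; apply: ltW; move: k; near: x.
  - by move=> k; rewrite FYx.
by rewrite ler_norml -/y; apply/andP; split; lra.
Unshelve. all: by end_near. Qed.

End Param.

(** * Derivative of the equilibrium map *)

Section Smooth.
Context {R : realType} {N : nat}.
Local Notation V := ('rV[R]_N * 'rV[R]_N * R)%type.
Variables (p : R) (Y : V -> 'rV[R]_N).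
Hypothesis p0 : 0 < p.
Hypothesis hY : forall z, paramdom z ->
  posvec (Y z) /\ equilibrium z.1.1 z.1.2 z.2 p (Y z).

(* The equilibrium equations have Jacobian [1 m^T - diag(decay)] in [y] and
   derivative [forcing] in the parameters. As a rank one perturbation of a
   diagonal matrix it is inverted explicitly (Sherman-Morrison). *)
Definition decay (i : 'I_N) (z : V) : R := \sum_(k < N) z.1.2 0 k -
  z.2 * z.1.1 0 i + z.2 * ((p + 1) * Y z 0 i `^ p).

Definition forcing (v : V) (i : 'I_N) (z : V) : R :=
  \sum_(k < N) v.1.2 0 k * (Y z 0 k - Y z 0 i) +
  (v.2 * z.1.1 0 i + z.2 * v.1.1 0 i) * Y z 0 i -
  v.2 * (Y z 0 i `^ p * Y z 0 i).

Definition dequilibrium (v : V) (i : 'I_N) (z : V) : R :=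
  ((\sum_(k < N) z.1.2 0 k * (forcing v k z / decay k z)) /
   (1 - \sum_(k < N) z.1.2 0 k / decay k z) + forcing v i z) / decay i z.

(** The equilibrium equation gives [decay k = S / y k + sigma p (y k)^p], with [S] the sum of the
    [m k y k]. So [m k / decay k < m k y k / S], and the right sides add up to 1. *)
Lemma decay_gt0 z i : paramdom z -> 0 < decay i z /\
  \sum_(k < N) z.1.2 0 k / decay k z < 1.
Proof.
move=> Uz; have [th0 [m0 s0]] := Uz; have [y0 /equilibriumE Fy] := hY Uz.
pose S := \sum_(k < N) z.1.2 0 k * Y z 0 k.
have S0 : 0 < S.
  rewrite /S (bigD1 i)//= ltr_wpDr ?mulr_gt0 ?m0 ?y0//.
  by apply: sumr_ge0 => k _; apply: mulr_ge0; apply: ltW; [exact: m0|exact: y0].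
have dE k : S / Y z 0 k < decay k z.
  rewrite ltr_pdivrMr ?y0//.
  have := Fy k; rewrite /field_OY; under eq_bigr do rewrite mulrBr.
  rewrite sumrB -mulr_suml -/S /decay => E.
  have : 0 < z.2 * (p * Y z 0 k `^ p) * Y z 0 k.
    by apply: mulr_gt0 (y0 k); rewrite !mulr_gt0 ?powR_gt0 ?y0.
  by lra.
have d0 k : 0 < decay k z by apply: lt_trans (dE k); rewrite divr_gt0 ?y0.
split => //.
apply: (@lt_le_trans _ _ (\sum_(k < N) z.1.2 0 k * Y z 0 k / S)).
  rewrite [ltLHS](bigD1 i)//= [ltRHS](bigD1 i)//=.
  have h k : z.1.2 0 k / decay k z < z.1.2 0 k * Y z 0 k / S.
    rewrite -mulrA ltr_pM2l ?m0// -(invrK (Y z 0 k)) -invfM ltf_pV2 ?posrE//.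
      by rewrite mulrC dE.
    by rewrite mulr_gt0 ?invr_gt0 ?y0.
  by rewrite ltr_leD// ler_sum// => k _; apply: ltW.
by rewrite -mulr_suml divff// gt_eqF.
Qed.

(** The equations at [P h] and at [z], subtracted, form a linear system for the increments whose
    coefficients [D h] and [B h] converge by continuity of the map. It is solved explicitly for
    small [h != 0], and the quotient passes to the limit. *)
Lemma equilibrium_map_is_derive z v i : paramdom z ->
  is_derive z v (fun x => Y x 0 i) (dequilibrium v i z).
Proof.
move=> Uz; have [th0 [m0 s0]] := Uz; have [y0 /equilibriumE Fy] := hY Uz.
pose P (h : R) : V := h *: v + z.
have Pcvg : P h @[h --> 0^'] --> z.
  apply: cvg_within_filter.
  have : {for (0 : R), continuous P}.
    apply: continuousD; last exact: cvg_cst.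
    exact: scalel_continuous.
  by rewrite /prop_for /continuous_at {2}/P scale0r add0r.
have thP h k : (P h).1.1 0 k = z.1.1 0 k + h * v.1.1 0 k.
  by rewrite /P /= !mxE addrC.
have mP h k : (P h).1.2 0 k = z.1.2 0 k + h * v.1.2 0 k.
  by rewrite /P /= !mxE addrC.
have sP h : (P h).2 = z.2 + h * v.2.
  by rewrite /P /= addrC.
pose phi (t : R) := t `^ p * t.
have phid k : is_derive (Y z 0 k) 1 phi ((p + 1) * Y z 0 k `^ p).
  have h := is_deriveM_fun (is_derive1_powR p (y0 k)) (is_derive_id (Y z 0 k) 1).
  by apply: (is_derive_eq h); rewrite mulr1 mulrCA mulr_powRB1 ?(ltW (y0 k))//; ring.
have slope k : exists S : R -> R,
    (forall t, phi t - phi (Y z 0 k) = S t * (t - Y z 0 k)) /\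
    S @ (Y z 0 k : R) --> (p + 1) * Y z 0 k `^ p.
  by have [S h1 h2] := caratheodory_slope (phid k); exists S.
have [S /= hS] := choice slope.
pose yP h k := Y (P h) 0 k.
have yPcvg k : yP h k @[h --> 0^'] --> Y z 0 k.
  apply: (@cvg_comp _ _ _ P (fun x => Y x 0 k) _ _ _ Pcvg).
  exact: (equilibrium_map_cvg p0 hY Uz).
have scvg : (P h).2 @[h --> 0^'] --> z.2.
  exact: (@cvg_comp _ _ _ P snd _ _ _ Pcvg (@cvg_snd _ _ _ _ _)).
have mcvg k : (P h).1.2 0 k @[h --> 0^'] --> z.1.2 0 k.
  exact: (@cvg_comp _ _ _ P _ _ _ _ Pcvg (@mass_coord_cvg _ _ z k)).
have thcvg k : (P h).1.1 0 k @[h --> 0^'] --> z.1.1 0 k.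
  exact: (@cvg_comp _ _ _ P _ _ _ _ Pcvg (@theta_coord_cvg _ _ z k)).
pose D h k := \sum_(j < N) (P h).1.2 0 j - (P h).2 * (P h).1.1 0 k +
  (P h).2 * S k (yP h k).
have Dcvg k : D h k @[h --> 0^'] --> decay k z.
  apply: cvgD.
    apply: cvgB; last exact: cvgM.
    exact: (cvg_sum_ord (f := fun j h => (P h).1.2 0 j)).
  apply: cvgM => //.
  exact: (@cvg_comp _ _ _ (yP ^~ k) (S k) _ _ _ (yPcvg k) (hS k).2).
(* Difference version of [forcing]; the term in [h] stems from the product of the increments of
   [sigma] and [theta]. *)
pose B h k := \sum_(j < N) v.1.2 0 j * (Y z 0 j - Y z 0 k) +
  (v.2 * z.1.1 0 k + z.2 * v.1.1 0 k + h * (v.2 * v.1.1 0 k)) * Y z 0 k -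
  v.2 * (Y z 0 k `^ p * Y z 0 k).
have Bcvg k : B h k @[h --> 0^'] --> forcing v k z.
  apply: cvgB; last exact: cvg_cst.
  apply: cvgD; first exact: cvg_cst.
  apply: cvgM; last exact: cvg_cst.
  rewrite -[X in _ --> X]addr0; apply: cvgD; first exact: cvg_cst.
  rewrite -[X in _ --> X](mul0r (v.2 * v.1.1 0 k)); apply: cvgM; last exact: cvg_cst.
  exact: (@cvg_within _ (nbhs (0 : R)) _ _).
have key h k : paramdom (P h) ->
    \sum_(j < N) (P h).1.2 0 j * (yP h j - Y z 0 j) - D h k * (yP h k - Y z 0 k)
    = - (h * B h k).
  move=> UP; have [_ /equilibriumE/(_ k) FP] := hY UP.
  have e1 : \sum_(j < N) (P h).1.2 0 j * (yP h j - Y z 0 j) -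
      (\sum_(j < N) (P h).1.2 0 j) * (yP h k - Y z 0 k) =
      \sum_(j < N) (P h).1.2 0 j * (yP h j - yP h k) -
      \sum_(j < N) z.1.2 0 j * (Y z 0 j - Y z 0 k) -
      h * \sum_(j < N) v.1.2 0 j * (Y z 0 j - Y z 0 k).
    rewrite mulr_suml mulr_sumr -!sumrB; apply: eq_bigr => j _.
    by rewrite mP; ring.
  have e2 := (hS k).1 (yP h k); rewrite /phi in e2.
  have e3 := Fy k; rewrite /field_OY mul1r in e3.
  rewrite /field_OY mul1r -/(yP h k) sP thP in FP.
  have FP' : \sum_(j < N) (P h).1.2 0 j * (yP h j - yP h k) =
      - ((z.2 + h * v.2) * (z.1.1 0 k + h * v.1.1 0 k - yP h k `^ p) * yP h k).
    by apply/eqP; rewrite -addr_eq0 FP.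
  have e3' : \sum_(j < N) z.1.2 0 j * (Y z 0 j - Y z 0 k) =
      - (z.2 * (z.1.1 0 k - Y z 0 k `^ p) * Y z 0 k).
    by apply/eqP; rewrite -addr_eq0 e3.
  transitivity (\sum_(j < N) (P h).1.2 0 j * (yP h j - Y z 0 j) -
      (\sum_(j < N) (P h).1.2 0 j) * (yP h k - Y z 0 k) +
      (P h).2 * (P h).1.1 0 k * (yP h k - Y z 0 k) -
      (P h).2 * (S k (yP h k) * (yP h k - Y z 0 k))).
    by rewrite /D; ring.
  by rewrite e1 FP' e3' -e2 sP thP /B; ring.
pose T h := (\sum_(k < N) (P h).1.2 0 k * (B h k / D h k)) /
            (1 - \sum_(k < N) (P h).1.2 0 k / D h k).
have dN0 k : decay k z != 0 by rewrite gt_eqF// (decay_gt0 k Uz).1.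
have qcvg k : B h k / D h k @[h --> 0^'] --> forcing v k z / decay k z.
  by apply: cvgM => //; apply: cvgV.
have mDcvg : \sum_(k < N) (P h).1.2 0 k / D h k @[h --> 0^'] -->
    \sum_(k < N) z.1.2 0 k / decay k z.
  apply: (cvg_sum_ord (f := fun k h => (P h).1.2 0 k / D h k)) => k.
  by apply: cvgM => //; exact: cvgV.
have Tcvg : T h @[h --> 0^'] -->
   (\sum_(k < N) z.1.2 0 k * (forcing v k z / decay k z)) /
   (1 - \sum_(k < N) z.1.2 0 k / decay k z).
  apply: cvgM.
    apply: (cvg_sum_ord (f := fun k h => (P h).1.2 0 k * (B h k / D h k))) => k.
    exact: cvgM.
  apply: cvgV; first by rewrite subr_eq0 gt_eqF// (decay_gt0 i Uz).2.
  by apply: cvgB => //; exact: cvg_cst.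
apply: is_derive_quotient.
have lim : (T h + B h i) / D h i @[h --> 0^'] --> dequilibrium v i z.
  apply: cvgM; first exact: cvgD.
  exact: cvgV.
apply: (@cvg_trans _ ((fun h => (T h + B h i) / D h i) @ 0^') _ _ _ lim).
apply: near_eq_cvg.
have nearU : \forall h \near (0 : R)^', paramdom (P h).
  exact: Pcvg (paramdom_near Uz).
have nearD : \forall h \near (0 : R)^', forall k, 0 < D h k.
  apply: filter_forall => k.
  exact: (cvgr_gt _ (Dcvg k) _ (decay_gt0 k Uz).1).
have nearS : \forall h \near (0 : R)^', \sum_(k < N) (P h).1.2 0 k / D h k < 1.
  exact: (cvgr_lt _ mDcvg _ (decay_gt0 i Uz).2).
near=> h.
have h0 : h != 0 by near: h; exact: nbhs_dnbhs_neq.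
have UP : paramdom (P h) by near: h.
have D0 k : D h k != 0 by rewrite gt_eqF//; move: k; near: h.
have S1 : 1 - \sum_(k < N) (P h).1.2 0 k / D h k != 0.
  by rewrite subr_eq0 gt_eqF//; near: h.
(* The system couples only through the scalar [W]: each increment is expressed by [W], and
   substituting back gives one equation for [W]. *)
pose W := \sum_(j < N) (P h).1.2 0 j * (yP h j - Y z 0 j).
have dE k : yP h k - Y z 0 k = (W + h * B h k) / D h k.
  have /eqP := key h k UP; rewrite subr_eq addrC -subr_eq opprK => /eqP E.
  by rewrite /W E mulrAC divff// mul1r.
have WE : W = h * T h.
  apply: (mulIf S1); rewrite /T mulrA divfK// mulrBr mulr1.
  rewrite {1}/W; under eq_bigr do rewrite dE.
  rewrite mulr_sumr mulr_sumr -sumrB; apply: eq_bigr => k _.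
  by field.
rewrite -/(P h) -/(yP h i) dE WE.
by field; rewrite h0 D0.
Unshelve. all: by end_near. Qed.

End Smooth.

Section SmoothClass.
Context {R : realType} {N : nat}.
Local Notation V := ('rV[R]_N * 'rV[R]_N * R)%type.
Variables (p : R) (Y : V -> 'rV[R]_N).
Hypothesis p0 : 0 < p.
Hypothesis hY : forall z, paramdom z ->
  posvec (Y z) /\ equilibrium z.1.1 z.1.2 z.2 p (Y z).

(* A class of functions closed under directional derivatives on the parameter
   domain; membership alone therefore gives smoothness. *)
Inductive rational_power_expr : (V -> R) -> Prop :=
| expr_cst c : rational_power_expr (fun=> c)
| expr_theta i : rational_power_expr (fun z => z.1.1 0 i)
| expr_mass i : rational_power_expr (fun z => z.1.2 0 i)
| expr_sigma : rational_power_expr (fun z => z.2)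
| expr_equilibrium i : rational_power_expr (fun z => Y z 0 i)
| expr_add f g : rational_power_expr f -> rational_power_expr g ->
    rational_power_expr (fun z => f z + g z)
| expr_mul f g : rational_power_expr f -> rational_power_expr g ->
    rational_power_expr (fun z => f z * g z)
| expr_inv f : rational_power_expr f -> (forall z, paramdom z -> f z != 0) ->
    rational_power_expr (fun z => (f z)^-1)
| expr_pow f a : rational_power_expr f -> (forall z, paramdom z -> 0 < f z) ->
    rational_power_expr (fun z => f z `^ a)
| expr_ext f g : rational_power_expr f -> (forall z, paramdom z -> f z = g z) ->
    rational_power_expr g.

Lemma expr_sub f g : rational_power_expr f -> rational_power_expr g ->
  rational_power_expr (fun z => f z - g z).
Proof.
move=> ef eg; apply: expr_ext (expr_add ef (expr_mul (expr_cst (-1)) eg)) _.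
by move=> z _; rewrite mulN1r.
Qed.

Lemma expr_sum (n : nat) (f : 'I_n -> V -> R) :
  (forall k, rational_power_expr (f k)) ->
  rational_power_expr (fun z => \sum_(k < n) f k z).
Proof.
move=> ef; elim: n f ef => [|n IH] f ef.
  by apply: expr_ext (expr_cst 0) _ => z _; rewrite big_ord0.
apply: expr_ext (expr_add (IH _ (fun k => ef (widen_ord (leqnSn n) k)))
  (ef ord_max)) _ => z _.
by rewrite big_ord_recr.
Qed.

Lemma expr_dequilibrium v i : rational_power_expr (dequilibrium p Y v i).
Proof.
have edecay k : rational_power_expr (decay p Y k).
  apply: expr_add.
    apply: expr_sub; first by apply: expr_sum => j; exact: expr_mass.
    by apply: expr_mul; [exact: expr_sigma|exact: expr_theta].
  apply: expr_mul; first exact: expr_sigma.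
  apply: expr_mul; first exact: expr_cst.
  apply: expr_pow; first exact: expr_equilibrium.
  by move=> z /hY[y0 _]; exact: y0.
have eforcing k : rational_power_expr (forcing p Y v k).
  apply: expr_sub.
    apply: expr_add.
      apply: expr_sum => j; apply: expr_mul; first exact: expr_cst.
      by apply: expr_sub; exact: expr_equilibrium.
    apply: expr_mul; last exact: expr_equilibrium.
    apply: expr_add; apply: expr_mul; try exact: expr_cst.
      exact: expr_theta.
    exact: expr_sigma.
  apply: expr_mul; first exact: expr_cst.
  apply: expr_mul; last exact: expr_equilibrium.
  apply: expr_pow; first exact: expr_equilibrium.
  by move=> z /hY[y0 _]; exact: y0.
have einv k : rational_power_expr (fun z => (decay p Y k z)^-1).
  apply: expr_inv => // z Uz.
  by rewrite gt_eqF// (decay_gt0 p0 hY k Uz).1.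
apply: expr_mul => //; apply: expr_add => //; apply: expr_mul.
  apply: expr_sum => k; apply: expr_mul; first exact: expr_mass.
  exact: expr_mul.
apply: expr_inv.
  apply: expr_sub; first exact: expr_cst.
  by apply: expr_sum => k; apply: expr_mul => //; exact: expr_mass.
by move=> z Uz; rewrite subr_eq0 gt_eqF// (decay_gt0 p0 hY i Uz).2.
Qed.

(** Induction on the expression; the derivative of the equilibrium itself is [dequilibrium], which
    lies in the class. *)
Lemma expr_is_derive f v : rational_power_expr f ->
  exists2 g, rational_power_expr g &
    forall z, paramdom z -> is_derive z v f (g z).
Proof.
elim=> [c|i|i||i|f1 f2 e1 [g1 eg1 d1] e2 [g2 eg2 d2]
  |f1 f2 e1 [g1 eg1 d1] e2 [g2 eg2 d2]|f1 e1 [g1 eg1 d1] f10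
  |f1 a e1 [g1 eg1 d1] f10|f1 f2 e1 [g1 eg1 d1] f12].
- exists (fun=> 0); first exact: expr_cst.
  by move=> z _; exact: is_derive_cst.
- exists (fun=> v.1.1 0 i); first exact: expr_cst.
  move=> z _; apply/is_derive_line => /=.
  rewrite (_ : (fun h => _) = (fun h : R => z.1.1 0 i + h * v.1.1 0 i)).
    by apply: is_derive_eq; rewrite /GRing.scale/=; ring.
  by apply/funext => h; rewrite !mxE addrC.
- exists (fun=> v.1.2 0 i); first exact: expr_cst.
  move=> z _; apply/is_derive_line => /=.
  rewrite (_ : (fun h => _) = (fun h : R => z.1.2 0 i + h * v.1.2 0 i)).
    by apply: is_derive_eq; rewrite /GRing.scale/=; ring.
  by apply/funext => h; rewrite !mxE addrC.
- exists (fun=> v.2); first exact: expr_cst.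
  move=> z _; apply/is_derive_line => /=.
  rewrite (_ : (fun h => _) = (fun h : R => z.2 + h * v.2)).
    by apply: is_derive_eq; rewrite /GRing.scale/=; ring.
  by apply/funext => h; rewrite addrC.
- exists (dequilibrium p Y v i); first exact: expr_dequilibrium.
  by move=> z Uz; exact: equilibrium_map_is_derive.
- exists (fun z => g1 z + g2 z); first exact: expr_add.
  by move=> z Uz; apply: is_deriveD_fun; [exact: d1|exact: d2].
- exists (fun z => f1 z * g2 z + f2 z * g1 z).
    by apply: expr_add; exact: expr_mul.
  by move=> z Uz; apply: is_deriveM_fun; [exact: d1|exact: d2].
- exists (fun z => (-1) * ((f1 z)^-1 * (f1 z)^-1) * g1 z).
    apply: expr_mul => //; apply: expr_mul; first exact: expr_cst.
    by apply: expr_mul; exact: expr_inv.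
  move=> z Uz; apply: (is_derive_eq (is_deriveV_fun (f10 z Uz) (d1 z Uz))).
  by rewrite mulN1r -invfM expr2.
- exists (fun z => a * f1 z `^ (a - 1) * g1 z).
    apply: expr_mul => //; apply: expr_mul; first exact: expr_cst.
    exact: expr_pow.
  move=> z Uz.
  exact: (is_derive_comp (d1 z Uz) (is_derive1_powR a (f10 z Uz))).
(* Equality on the parameter domain suffices because the domain is open. *)
- exists g1 => // z Uz; apply: near_eq_is_derive (d1 z Uz).
  by near=> x; apply: f12; near: x; exact: paramdom_near.
Unshelve. all: by end_near. Qed.

Lemma expr_cvg f z : rational_power_expr f -> paramdom z -> f @ z --> f z.
Proof.
move=> ef Uz; elim: ef => [c|i|i||i|f1 f2 e1 c1 e2 c2|f1 f2 e1 c1 e2 c2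
  |f1 e1 c1 f10|f1 a e1 c1 f10|f1 f2 e1 c1 f12].
- exact: cvg_cst.
- exact: theta_coord_cvg.
- exact: mass_coord_cvg.
- exact: cvg_snd.
- exact: (equilibrium_map_cvg p0 hY Uz).
- exact: cvgD.
- exact: cvgM.
- by apply: cvgV => //; exact: f10.
- apply: (@cvg_comp _ _ _ f1 (@powR R ^~ a) _ _ _ c1).
  exact: is_derive_continuous (is_derive1_powR a (f10 z Uz)).
- rewrite -f12//; apply: (@cvg_trans _ (f1 @ z) _ _ _ c1).
  apply: near_eq_cvg; near=> x; apply: f12; near: x; exact: paramdom_near.
Unshelve. all: by end_near. Qed.

(** Membership of the coordinates in the class is the induction invariant: those of a directional
    derivative agree on the domain with functions of the class. *)
Lemma expr_smooth (n : nat) (f : V -> 'rV[R]_n) :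
  (forall i, rational_power_expr (fun z => f z 0 i)) ->
  smooth_on (@paramdom R N) f.
Proof.
move=> ef k; elim: k f ef => [|k IH] f ef /=.
  apply/subspace_continuousP => z Uz.
  apply: cvg_within_filter; apply: cvg_row => i.
  exact: expr_cvg.
move=> v.
have fd z : paramdom z -> derivable f z v.
  move=> Uz; apply/derivable_mxP => i j; rewrite ord1.
  by have [g _ /(_ z Uz)[]] := expr_is_derive v (ef j).
split => //; apply: IH => i.
have [g eg gd] := expr_is_derive v (ef i).
apply: expr_ext eg _ => z Uz.
by rewrite derive_mx ?mxE; [have [_ ->] := gd z Uz|exact: fd].
Qed.

End SmoothClass.

Theorem theorem5p1 (R : realType) (N n : nat) (p : R) :
  (1 <= N)%N -> (1 <= n)%N -> 0 < p ->
  (* the equilibrium map (theta, m, sigma) |-> y* is C^oo *)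
  (exists Y : 'rV[R]_N * 'rV[R]_N * R -> 'rV[R]_N,
     smooth_on (@paramdom R N) Y /\
     forall z, @paramdom R N z ->
       posvec (Y z) /\ equilibrium z.1.1 z.1.2 z.2 p (Y z)) /\
  forall (theta m : 'rV[R]_N) (sigma : R),
    posvec theta -> posvec m -> 0 < sigma ->
    exists ystar : 'rV[R]_N,
      (* unique positive equilibrium *)
      (posvec ystar /\ equilibrium theta m sigma p ystar) /\
      (forall y, posvec y -> equilibrium theta m sigma p y -> y = ystar) /\
      (* locally exponentially stable for (OY) *)
      loc_exp_stable theta m sigma p ystar /\
      (* sectorial solutions of (OV) converge to y*_i times a unit vector *)
      (forall v : R -> 'I_N -> 'rV[R]_n,
         solOV theta m sigma p v -> sectorial v ->
         exists u : 'rV[R]_n, enorm u = 1 /\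
           forall i, (fun t => v t i) @ +oo --> ystar 0 i *: u) /\
      (* positive solutions of (OY) converge to y* *)
      (forall y : R -> 'rV[R]_N,
         solOY theta m sigma p +oo%E y -> posvec (y 0) ->
         y @ +oo --> ystar).
Proof.
move=> N0 n0 p0.
have ex (theta m : 'rV[R]_N) (sigma : R) : posvec theta -> posvec m ->
    0 < sigma -> exists y, posvec y /\ equilibrium theta m sigma p y.
  move=> th0 m0 s0; have [y [y0 Fy]] := equilibrium_ex th0 m0 s0 p0.
  exists (\row_i y i); split; first by move=> i; rewrite mxE.
  apply/equilibriumE => i; rewrite -(Fy i); congr field_OY.
  by apply/funext => k; rewrite mxE.
split.
  have ex' (z : 'rV[R]_N * 'rV[R]_N * R) : exists y, paramdom z ->
      posvec y /\ equilibrium z.1.1 z.1.2 z.2 p y.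
    have [[th0 [m0 s0]]|nU] := pselect (paramdom z).
      by have [y] := ex _ _ _ th0 m0 s0; exists y.
    (* Outside the parameter domain the selected value is a mere default. *)
    by exists 0.
  have [Y hY] := choice ex'.
  exists Y; split => //.
  by apply: (expr_smooth p0 hY) => i; exact: expr_equilibrium.
move=> theta m sigma th0 m0 s0.
have [z [z0 Fz]] := ex _ _ _ th0 m0 s0; exists z; split => //.
have Fz' := (equilibriumE _ _ _ _ z).1 Fz.
split.
  move=> y y0 /equilibriumE Fy; apply/rowP => i.
  exact: (equilibrium_uniq m0 s0 p0 y0 z0 Fy Fz').
split; first exact: equilibrium_loc_exp_stable.
split.
  by move=> v sv secv; exact: (solOV_cvg th0 m0 s0 p0 sv N0 secv z0 Fz').
by move=> y sy y0; exact: (solOY_cvg m0 s0 p0 z0 Fz sy y0).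
Qed.
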